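(* Let $(N,M,V,G)$ be a problem instance with $|N|>2$ in which every item value satisfies $v_{ij}\in\{0,1\}$ for all $i\in N$, $j\in M$, and every connected component of $G$ is a path. Then the instance has an EF1 allocation, which may be found in polynomial time.
   Context: A problem instance is a quadruple $(N,M,V,G)$, where $N$ is a finite set of $n$ agents, $M$ is a finite set of $m$ items, $V$ is a family of additive valuation functions $v_i:2^M\to\mathbb{R}_{\ge 0}$, $i\in N$ (write $v_{ij}=v_i(\{j\})$), and $G=(M,E)$ is an undirected (simple) conflict graph on the items. An allocation is an ordered partition $A=\langle A_i\rangle_{i\in N}$ of all of $M$ into $|N|$ (possibly empty) bundles; it is feasible if every bundle is an independent set of $G$. A feasible allocation $A$ is EF1 (envy-free up to one good) if for all $i,i'\in N$ with $A_{i'}\neq\emptyset$, $v_i(A_i)\ge v_i(A_{i'})-\max_{j\in A_{i'}}v_{ij}$. A single vertex counts as a path. Polynomial time is measured in the number of agents and items. *)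

(* Defs.v *)
From mathcomp Require Import all_boot all_order all_algebra.

Set Implicit Arguments.
Unset Strict Implicit.
Unset Printing Implicit Defensive.

Import Order.TTheory GRing.Theory Num.Theory.

(* Agents are 'I_(nagents I), items are 'I_(nitems I).                        *)
Record instance (R : realFieldType) := Instance {
  nagents : nat;
  nitems : nat;
  valuation : 'I_nagents -> {set 'I_nitems} -> R;
  valuation_ge0 : forall i S, (0 <= valuation i S)%R;
  valuation_additive : forall i S,
    valuation i S = (\sum_(j in S) valuation i [set j])%R;
  conflict : rel 'I_nitems;
  conflict_sym : symmetric conflict;
  conflict_irr : irreflexive conflict }.

Section Graphs.
Variables (T : finType) (e : rel T).

Definition component (x : T) : {set T} := [set y | connect e x y].

(* The subgraph of e induced by C is a path: C can be listed without          *)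
(* repetition so that the edges are exactly the pairs of neighbours in the    *)
(* list.  A one-element list is allowed.                                      *)
Definition induces_path (C : {set T}) : Prop :=
  exists s : seq T, [/\ uniq s, s =i C &
    {in C &, forall x y, e x y = ((index x s).+1 == index y s)
                              || ((index y s).+1 == index x s)}].

Definition components_are_paths : Prop := forall x, induces_path (component x).

Definition independent (S : {set T}) : Prop := {in S &, forall x y, ~~ e x y}.

End Graphs.

Section Fairness.
Variables (R : realFieldType) (I : instance R).

Definition item_value (i : 'I_(nagents I)) (j : 'I_(nitems I)) : R :=
  valuation i [set j].

Definition binary_values : Prop :=
  forall i j, item_value i j = 0%R \/ item_value i j = 1%R.

Definition bundles := 'I_(nagents I) -> {set 'I_(nitems I)}.

Definition is_allocation (A : bundles) : Prop :=
  \bigcup_i A i = [set: 'I_(nitems I)] /\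
  (forall i i', i != i' -> [disjoint A i & A i']).

Definition feasible (A : bundles) : Prop :=
  forall i, independent (@conflict R I) (A i).

(* Valuations are nonnegative, so the default 0 of the iterated maximum does  *)
(* not change its value on a nonempty bundle.                                 *)
Definition ef1 (A : bundles) : Prop :=
  forall i i', A i' != set0 ->
    (valuation i (A i') - \big[Order.max/0]_(j in A i') item_value i j
       <= valuation i (A i))%R.

Definition ef1_allocation (A : bundles) : Prop :=
  [/\ is_allocation A, feasible A & ef1 A].

End Fairness.

(* Model of computation: a random access machine whose memory is a family of  *)
(* two-dimensional arrays of natural numbers (a program mentions finitely     *)
(* many of them), programmed by while-programs under the uniform cost         *)
(* measure.  Arithmetic is limited to addition and truncated subtraction:     *)
(* bit lengths then grow by O(1) per step, so that running times agree with   *)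
(* Turing machine running times up to a polynomial.  Multiplication at unit   *)
(* cost would break this.                                                     *)

Definition memory := nat -> nat -> nat -> nat.

Inductive expr :=
  | Const of nat
  | Read of nat & expr & expr
  | Add of expr & expr
  | Sub of expr & expr.

Fixpoint eval (s : memory) (x : expr) : nat :=
  match x with
  | Const k => k
  | Read a x1 x2 => s a (eval s x1) (eval s x2)
  | Add x1 x2 => eval s x1 + eval s x2
  | Sub x1 x2 => eval s x1 - eval s x2
  end.

Fixpoint expr_cost (x : expr) : nat :=
  match x with
  | Const _ => 1
  | Read _ x1 x2 | Add x1 x2 | Sub x1 x2 => (expr_cost x1 + expr_cost x2).+1
  end.

(* Write a x1 x2 y is the assignment a[x1, x2] := y; a test succeeds when its *)
(* value is nonzero.                                                          *)
Inductive program :=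
  | Skip
  | Write of nat & expr & expr & expr
  | Seq of program & program
  | If of expr & program & program
  | While of expr & program.

Definition update (s : memory) (a i j k : nat) : memory :=
  fun a' i' j' => if [&& a' == a, i' == i & j' == j] then k else s a' i' j'.

(* exec c s s' t: started in memory s, the program c halts in memory s' after *)
(* t steps.                                                                   *)
Inductive exec : program -> memory -> memory -> nat -> Prop :=
  | ExecSkip s : exec Skip s s 1
  | ExecWrite s a x1 x2 y :
      exec (Write a x1 x2 y) s
           (update s a (eval s x1) (eval s x2) (eval s y))
           (expr_cost x1 + expr_cost x2 + expr_cost y).+1
  | ExecSeq c1 c2 s s1 s2 t1 t2 :
      exec c1 s s1 t1 -> exec c2 s1 s2 t2 -> exec (Seq c1 c2) s s2 (t1 + t2)
  | ExecIfTrue x c1 c2 s s1 t :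
      eval s x != 0 -> exec c1 s s1 t ->
      exec (If x c1 c2) s s1 (expr_cost x + t).+1
  | ExecIfFalse x c1 c2 s s1 t :
      eval s x = 0 -> exec c2 s s1 t ->
      exec (If x c1 c2) s s1 (expr_cost x + t).+1
  | ExecWhileTrue x c s s1 s2 t1 t2 :
      eval s x != 0 -> exec c s s1 t1 -> exec (While x c) s1 s2 t2 ->
      exec (While x c) s s2 (expr_cost x + t1 + t2).+1
  | ExecWhileFalse x c s :
      eval s x = 0 -> exec (While x c) s s (expr_cost x).+1.

Section Solving.
Variable R : realFieldType.

(* Array 0 holds the number of agents and array 1 the number of items, both   *)
(* in cell [0, 0]; array 2 holds the item values (0 or 1 for instances with   *)
(* binary values, the only ones for which this encoding is meant) and array 3 *)
(* the adjacency matrix of the conflict graph.  All other cells are 0.        *)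
Definition binary_input (I : instance R) : memory := fun a i j =>
  match a with
  | 0 => if (i == 0) && (j == 0) then nagents I else 0
  | 1 => if (i == 0) && (j == 0) then nitems I else 0
  | 2 => if (insub i, insub j) is (Some i, Some j)
         then nat_of_bool (item_value (I := I) i j == 1%R) else 0
  | 3 => if (insub i, insub j) is (Some i, Some j)
         then nat_of_bool (@conflict R I i j) else 0
  | _ => 0
  end.

(* Cell [j, 0] of array 4 holds the agent who receives item j.                *)
Definition output (I : instance R) (s : memory) : bundles I :=
  fun i => [set j : 'I_(nitems I) | s 4 j 0 == i].

(* One program, and one polynomial bound in the number of agents and items,   *)
(* for all the instances satisfying P.                                        *)
Definition found_in_polynomial_time (P : instance R -> Prop)
    (Q : forall I : instance R, bundles I -> Prop) : Prop :=
  exists (c : program) (a k : nat), forall I : instance R, P I ->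
    exists (s : memory) (t : nat),
      [/\ exec c (binary_input I) s t,
          t <= a * (nagents I + nitems I) ^ k
        & Q I (@output I s)].

End Solving.

(* Main.v *)
Require Import Defs.
From mathcomp Require Import all_boot all_order all_algebra zify.

(* List the items along the paths, so that conflicts only occur between       *)
(* consecutive items, and hand them out in this order.  Let l be the owner of *)
(* the previous item.  Giving the current item to an agent a <> l keeps the   *)
(* allocation EF1 as soon as nobody who likes the item envies a; call such an *)
(* a valid.  After each step envy cycles are rotated away, so envy is         *)
(* acyclic.  The invariant ensuring that a valid agent always exists is: some *)
(* valid agent likes the current item, or there are two valid agents.  It is  *)
(* maintained by looking one item ahead.  Give the item to a valid agent who  *)
(* likes it if there is one: this agent then envies nobody.  Otherwise prefer *)
(* a valid agent who dislikes the next item or is envied by somebody liking   *)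
(* it.  If the invariant failed at the next item, all agents but the last     *)
(* owner and at most one agent disliking the item would be envied by agents   *)
(* liking it; with at least three agents, following envy backwards then runs  *)
(* into a cycle or contradicts the choice of the last owner.                  *)

(** With values 0 and 1, EF1 follows once nobody values another bundle above their own by more than
    one item; this is [envy_bounded]. It survives the placement of an item with any [valid] agent.
    Passing whole bundles along an envy cycle ([rotation]) preserves this bound and the independence
    of the bundles, and strictly raises the total worth of own bundles, which never exceeds [n * m].
    So [n * m] rounds after each placement leave envy acyclic ([rotation_facts], [acyclic_of_max],
    [untangledS]).

    Feasibility asks for a recipient other than the owner of the preceding item, and the invariant
    [good] provides one. By [good_of_content], with three agents and acyclic envy, [good] holds as
    soon as the last owner envies nobody or dislikes the next item. The last owner envies nobody if
    a rotation took place after the last placement ([rotation_moved]), or if the recipient liked the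
    item. In the remaining case the lookahead in [choice] yields the invariant directly; [good_step]
    puts the cases together.

    For the running time the procedure is an explicit program whose loops all range over agents or
    items, so [exec_block] bounds its cost by a polynomial; [run_main] proves it correct. The
    existence of an EF1 allocation is read off its output. *)

Set Implicit Arguments.
Unset Strict Implicit.
Unset Printing Implicit Defensive.

Import Order.TTheory GRing.Theory Num.Theory.

(* [eqtype] exports another [Sub].                                            *)
Local Notation Sub := Defs.Sub.

(** * Structured programs with bounded loops *)

(* [BFor x b p] runs p for the counter x = 0, 1, ... below cell [0, 0] of    *)
(* array b, which holds the number of agents or of items.                     *)
Inductive block :=
  | BWrite of nat & expr & expr & expr
  | BSeq of block & block
  | BIf of expr & block
  | BFor of nat & nat & block.

Definition var (x : nat) : expr := Read x (Const 0) (Const 0).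

Fixpoint compile (p : block) : program :=
  match p with
  | BWrite a x1 x2 y => Write a x1 x2 y
  | BSeq p1 p2 => Seq (compile p1) (compile p2)
  | BIf e p1 => If e (compile p1) Skip
  | BFor x b p1 =>
      Seq (Write x (Const 0) (Const 0) (Const 0))
          (While (Sub (var b) (var x))
             (Seq (compile p1)
                  (Write x (Const 0) (Const 0) (Add (var x) (Const 1)))))
  end.

Fixpoint loop (f : memory -> memory) x i d (s : memory) : memory :=
  if d is d'.+1 then loop f x i.+1 d' (update (f s) x 0 0 i.+1) else s.

Fixpoint run (p : block) (s : memory) : memory :=
  match p with
  | BWrite a x1 x2 y => update s a (eval s x1) (eval s x2) (eval s y)
  | BSeq p1 p2 => run p2 (run p1 s)
  | BIf e p1 => if eval s e != 0 then run p1 s else s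
  | BFor x b p1 => loop (run p1) x 0 (s b 0 0) (update s x 0 0 0)
  end.

Fixpoint writes (a : nat) (p : block) : bool :=
  match p with
  | BWrite a' _ _ _ => a == a'
  | BSeq p1 p2 => writes a p1 || writes a p2
  | BIf _ p1 => writes a p1
  | BFor x _ p1 => (a == x) || writes a p1
  end.

(** Arrays 0 and 1 hold the loop bounds and are never written, and a body never touches its own
    counter. Hence the number of rounds is known when a loop starts. *)
Fixpoint well_formed (p : block) : bool :=
  match p with
  | BWrite a _ _ _ => 1 < a
  | BSeq p1 p2 => well_formed p1 && well_formed p2
  | BIf _ p1 => well_formed p1
  | BFor x b p1 => [&& 1 < x, b < 2, ~~ writes x p1 & well_formed p1]
  end.

Lemma update_eq s a i j k : update s a i j k a i j = k.
Proof. by rewrite /update !eqxx. Qed.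

Lemma update_array s a a' i j i' j' k : a' != a -> update s a i j k a' i' j' = s a' i' j'.
Proof. by rewrite /update => /negPf ->. Qed.

Lemma update_cell s a i j i' j' k :
  (i', j') != (i, j) -> update s a i j k a i' j' = s a i' j'.
Proof. by rewrite /update xpair_eqE eqxx /= => /negPf ->. Qed.

Lemma run_seq p1 p2 s : run (BSeq p1 p2) s = run p2 (run p1 s).
Proof. by []. Qed.

Lemma run_write a x1 x2 y s :
  run (BWrite a x1 x2 y) s = update s a (eval s x1) (eval s x2) (eval s y).
Proof. by []. Qed.

Lemma run_frame p s a i j : ~~ writes a p -> run p s a i j = s a i j.
Proof.
elim: p s => [a' x1 x2 y|p1 IH1 p2 IH2|e p1 IH1|x b p1 IH1] s /=.
- exact: update_array.
- by rewrite negb_or => /andP[h1 h2]; rewrite IH2 // IH1.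
- by case: ifP => // _; apply: IH1.
- rewrite negb_or => /andP[ax h1].
  rewrite -[RHS](@update_array s x a 0 0 i j 0) //.
  have fr d k s' : loop (run p1) x k d s' a i j = s' a i j.
    by elim: d k s' => //= d IHd k s'; rewrite IHd update_array // IH1.
  exact: fr.
Qed.

Lemma well_formed_writes p a : well_formed p -> a < 2 -> ~~ writes a p.
Proof.
elim: p => [a' x1 x2 y|p1 IH1 p2 IH2|e p1 IH1|x b p1 IH1] /=.
- by lia.
- by case/andP => h1 h2 a2; rewrite negb_or IH1 ?IH2.
- exact: IH1.
- by case/and4P => x1 _ _ h a2; rewrite negb_or IH1 // andbT; lia.
Qed.

(** Each loop multiplies the cost of its body by at most [N]. Adding the exponents in a sequence
    gives a power of [N] that dominates both parts. *)
Lemma exec_block p : well_formed p -> exists a k, forall s N,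
  0 < N -> s 0 0 0 <= N -> s 1 0 0 <= N ->
  exists2 t, exec (compile p) s (run p s) t & t <= a * N ^ k.
Proof.
elim: p => [a' x1 x2 y|p1 IH1 p2 IH2|e p1 IH1|x b p1 IH1] /=.
- move=> _; exists (expr_cost x1 + expr_cost x2 + expr_cost y).+1, 0 => s N _ _ _.
  by eexists; [exact: ExecWrite | rewrite expn0 muln1].
- case/andP => w1 w2.
  have [a1 [k1 {}IH1]] := IH1 w1; have [a2 [k2 {}IH2]] := IH2 w2.
  exists (a1 + a2), (k1 + k2) => s N N0 s0 s1.
  have [t1 e1 b1] := IH1 s N N0 s0 s1.
  have [||t2 e2 b2] := IH2 (run p1 s) N N0; rewrite ?run_frame ?well_formed_writes //.
  exists (t1 + t2); first exact: ExecSeq e1 e2.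
  rewrite mulnDl leq_add //.
    by apply: leq_trans b1 _; rewrite leq_mul2l expnD leq_pmulr ?orbT // expn_gt0 N0.
  by apply: leq_trans b2 _; rewrite leq_mul2l expnD leq_pmull ?orbT // expn_gt0 N0.
- move=> w1; have [a1 [k1 {}IH1]] := IH1 w1.
  exists (expr_cost e + a1 + 2), k1 => s N N0 s0 s1.
  have NN : 0 < N ^ k1 by rewrite expn_gt0 N0.
  have [t1 e1 b1] := IH1 s N N0 s0 s1.
  case: ifPn => [he|]; last rewrite negbK => /eqP he.
    exists (expr_cost e + t1).+1; first exact: ExecIfTrue.
    by nia.
  exists (expr_cost e + 1).+1; first by apply: ExecIfFalse => //; exact: ExecSkip.
  by nia.
- case/and4P => x1 b2 wx w1; have [a1 [k1 {}IH1]] := IH1 w1.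
  (* A failing loop test costs 8, a successful one together with the increment of the counter costs
     16, and resetting the counter costs 4. *)
  exists (a1 + 30), k1.+1 => s N N0 s0 s1.
  have NN : 0 < N ^ k1 by rewrite expn_gt0 N0.
  have bx : b != x by lia.
  pose W := While (Sub (var b) (var x))
             (Seq (compile p1) (Write x (Const 0) (Const 0) (Add (var x) (Const 1)))).
  have main d i s' : s' x 0 0 = i -> s' b 0 0 = i + d ->
      s' 0 0 0 <= N -> s' 1 0 0 <= N ->
      exists2 t, exec W s' (loop (run p1) x i d s') t & t <= 8 + d * (a1 * N ^ k1 + 16).
    elim: d i s' => [|d IHd] i s' xi bi s0' s1' /=.
      exists (expr_cost (Sub (var b) (var x))).+1; last by rewrite /=; lia.
      by apply: ExecWhileFalse; rewrite /= xi bi; lia.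
    have [t1 e1 l1] := IH1 s' N N0 s0' s1'.
    have [||||t2 e2 l2] := IHd i.+1 (update (run p1 s') x 0 0 i.+1).
    + by rewrite update_eq.
    + rewrite update_array // run_frame ?bi ?addSnnS //.
      by apply: well_formed_writes.
    + by rewrite update_array ?run_frame ?well_formed_writes //; lia.
    + by rewrite update_array ?run_frame ?well_formed_writes //; lia.
    eexists.
      apply: (ExecWhileTrue _ _ e2); first by rewrite /= xi bi; lia.
      apply: (ExecSeq e1).
      have -> : i.+1 = eval (run p1 s') (Add (var x) (Const 1)).
        by rewrite /= run_frame // xi addn1.
      exact: ExecWrite.
    by rewrite /=; nia.
  have [||||t e l] := main (s b 0 0) 0 (update s x 0 0 0).
  + by rewrite update_eq.
  + by rewrite update_array.
  + by rewrite update_array //; lia.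
  + by rewrite update_array //; lia.
  eexists; first by apply: (ExecSeq _ e); exact: ExecWrite.
  have sb : s b 0 0 <= N.
    have [->|->] : b = 0 \/ b = 1 by lia.
      exact: s0.
    exact: s1.
  have h1 : s b 0 0 * (a1 * N ^ k1 + 16) <= N * (a1 * N ^ k1 + 16).
    by rewrite leq_mul2r sb orbT.
  have h2 : N <= N * N ^ k1 by rewrite leq_pmulr.
  rewrite expnS /=; nia.
Qed.

(** The invariant rule for loops. It also hands over the frame condition with respect to the memory
    before the loop, so that invariants need only mention the arrays that change. *)
Lemma run_for (P : nat -> memory -> Prop) x b p s :
  ~~ writes x p ->
  P 0 (update s x 0 0 0) ->
  (forall i s', i < s b 0 0 -> s' x 0 0 = i ->
     (forall a j k, a != x -> ~~ writes a p -> s' a j k = s a j k) ->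
     P i s' -> P i.+1 (update (run p s') x 0 0 i.+1)) ->
  P (s b 0 0) (run (BFor x b p) s).
Proof.
move=> wx P0 PS /=.
suff main d i s' : P i s' -> i + d = s b 0 0 -> s' x 0 0 = i ->
    (forall a j k, a != x -> ~~ writes a p -> s' a j k = s a j k) ->
    P (s b 0 0) (loop (run p) x i d s').
  apply: main => //; first by rewrite update_eq.
  by move=> a j k ax _; rewrite update_array.
elim: d i s' => [|d IHd] i s' Pi; first by rewrite addn0 => <-.
move=> id xi fr /=; apply: IHd.
- by apply: PS => //; lia.
- by rewrite -id addSnnS.
- by rewrite update_eq.
- by move=> a j k ax aw; rewrite update_array // run_frame // fr.
Qed.

(** * Boolean tests, sums, searches and tables as program fragments *)

Definition eNot e := Sub (Const 1) e.
Definition eAnd e1 e2 := eNot (Add (eNot e1) (eNot e2)).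
Definition eEq e1 e2 := eNot (Add (Sub e1 e2) (Sub e2 e1)).

Lemma eval_not s e : eval s (eNot e) = (eval s e == 0).
Proof. by rewrite /=; case: (eval s e). Qed.

Lemma eval_and s e1 e2 : eval s (eAnd e1 e2) = (eval s e1 != 0) && (eval s e2 != 0).
Proof. by rewrite eval_not /=; case: (eval s e1); case: (eval s e2). Qed.

Lemma eval_eq s e1 e2 : eval s (eEq e1 e2) = (eval s e1 == eval s e2).
Proof. by rewrite eval_not /=; congr nat_of_bool; lia. Qed.

Definition summation T e1 e2 z b e :=
  BSeq (BWrite T e1 e2 (Const 0))
       (BFor z b (BWrite T e1 e2 (Add (Read T e1 e2) e))).

Lemma run_summation (F : nat -> nat) (T : nat) e1 e2 (z b : nat) e (r c : nat) s :
  T != z -> T != b -> eval s e1 = r -> eval s e2 = c ->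
  (forall s' k, (forall a i j, a != T -> a != z -> s' a i j = s a i j) ->
     s' z 0 0 = k -> k < s b 0 0 ->
     [/\ eval s' e1 = r, eval s' e2 = c & eval s' e = F k]) ->
  run (summation T e1 e2 z b e) s T r c = \sum_(k < s b 0 0) F k /\
  forall i j, (i, j) != (r, c) ->
    run (summation T e1 e2 z b e) s T i j = s T i j.
Proof.
move=> Tz Tb er ec H.
rewrite /summation [run _ _]/=.
set s1 := update s T _ _ _.
have -> : s b 0 0 = s1 b 0 0 by rewrite /s1 update_array // eq_sym.
pose P k (s' : memory) := s' T r c = \sum_(i < k) F i /\
   forall i j, (i, j) != (r, c) -> s' T i j = s T i j.
apply: (@run_for P z b (BWrite T e1 e2 (Add (Read T e1 e2) e)) s1).
- by rewrite /= eq_sym.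
- rewrite /P big_ord0 /s1 er ec update_array // update_eq; split=> // i j ij.
  by rewrite update_array // update_cell.
- move=> i s' ib zi fr [h1 h2].
  have [|||f1 f2 f3] := H s' i => //.
    move=> a j k aT az; rewrite fr //= /s1 update_array //.
    by rewrite /s1 update_array // eq_sym in ib.
  rewrite /P /= f1 f2 f3 update_array // update_eq big_ord_recr /= h1; split=> // j k jk.
  by rewrite update_array // update_cell // h2.
Qed.

(** Every hit overwrites the target, and without a hit the old content stays. Successive searches
    into one cell therefore give precedence to the later ones. *)
Definition search T e1 e2 z b e := BFor z b (BIf e (BWrite T e1 e2 (var z))).

Lemma run_search (C : nat -> bool) (T : nat) e1 e2 (z : nat) b e (r c : nat) s :
  T != z ->
  (forall s' k, (forall a i j, a != T -> a != z -> s' a i j = s a i j) ->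
     s' z 0 0 = k -> k < s b 0 0 ->
     [/\ eval s' e1 = r, eval s' e2 = c & (eval s' e != 0) = C k]) ->
  let s1 := run (search T e1 e2 z b e) s in
  (if has C (iota 0 (s b 0 0)) then (s1 T r c < s b 0 0) && C (s1 T r c)
   else s1 T r c == s T r c) /\
  forall i j, (i, j) != (r, c) -> s1 T i j = s T i j.
Proof.
move=> Tz H s1.
pose P k (s' : memory) :=
  (if has C (iota 0 k) then (s' T r c < k) && C (s' T r c)
   else s' T r c == s T r c) /\
  forall i j, (i, j) != (r, c) -> s' T i j = s T i j.
apply: (@run_for P z b (BIf e (BWrite T e1 e2 (var z))) s).
- by rewrite /= eq_sym.
- by rewrite /P /= update_array //; split=> // i j _; rewrite update_array.
- move=> i s' ib zi fr [h1 h2].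
  have [|||f1 f2 f3] := H s' i => //.
    by move=> a j k aT az; rewrite fr.
  rewrite /P -addn1 iotaD has_cat /= orbF add0n f1 f2 f3 zi.
  rewrite update_array //; case: (boolP (C i)) => Ci; rewrite ?orbT ?orbF.
    rewrite update_eq Ci addn1 ltnSn; split=> // j k jk.
    by rewrite update_array // update_cell // h2.
  split; last by move=> j k jk; rewrite update_array // h2.
  move: h1; case: ifP => // _ /andP[h ->]; rewrite andbT; lia.
Qed.

Definition tabulate T x b e := BFor x b (BWrite T (var x) (Const 0) e).

Lemma run_tabulate (F : nat -> nat) (T x : nat) b e s :
  T != x ->
  (forall s' k, (forall a i j, a != T -> a != x -> s' a i j = s a i j) ->
     s' x 0 0 = k -> k < s b 0 0 -> s' T k 0 = s T k 0 -> eval s' e = F k) ->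
  let s1 := run (tabulate T x b e) s in
  (forall k, k < s b 0 0 -> s1 T k 0 = F k) /\
  (forall k, s b 0 0 <= k -> s1 T k 0 = s T k 0).
Proof.
move=> Tx H s1.
pose P k (s' : memory) := (forall i, i < k -> s' T i 0 = F i) /\
  (forall i, k <= i -> s' T i 0 = s T i 0).
apply: (@run_for P x b (BWrite T (var x) (Const 0) e) s).
- by rewrite /= eq_sym.
- by rewrite /P; split=> // i _; rewrite update_array.
- move=> i s' ib xi fr [h1 h2] /=.
  have f := H s' i (fun a j k aT ax => fr a j k ax aT) xi ib (h2 i (leqnn i)).
  rewrite /P xi f; split=> k ik; rewrite update_array //.
    have [->|ki] := eqVneq k i; first by rewrite update_eq.
    by rewrite update_cell ?xpair_eqE ?(negPf ki) // h1 //; lia.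
  by rewrite update_cell ?xpair_eqE ?h2 //; lia.
Qed.

#[local] Opaque run.

(** * Envy, rotations and the lookahead rule *)

Section Envy.
Variables (n m : nat) (like : nat -> nat -> bool).
Implicit Types (f g : nat -> nat) (L : pred nat).

(** An item not yet handed out has an owner outside the agents; the program uses the number [n]. *)
Definition worth f i a := \sum_(j < m) (like i j && (f j == a)).
Definition envies f i a := worth f i i < worth f i a.
Definition envied f L a := has (fun i => L i && envies f i a) (iota 0 n).
Definition envy_bounded f := forall i a, i < n -> a < n -> worth f i a <= (worth f i i).+1.
Definition content f i := forall a, a < n -> worth f i a <= worth f i i.
(** A nonempty set of this kind contains an envy cycle, found by following enviers backwards, and
    every cycle is such a set. Sets are easier to exhibit in the proofs than cycles. *)
Definition envy_closed f (W : pred nat) :=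
  forall x, W x -> x < n /\ exists2 y, W y & envies f y x.
Definition acyclic f := forall W : pred nat, envy_closed f W -> forall x, ~~ W x.
Definition valid f l L a := [&& a < n, a != l & ~~ envied f L a].
(* l owns the previous item and L is the set of agents who like the next one. *)
Definition good f l L :=
  (exists2 a, valid f l L a & L a) \/
  (exists a b, [/\ valid f l L a, valid f l L b & a != b]).
Definition place f j c x := if x == j then c else f x.

Lemma enviedP f L a :
  reflect (exists i, [/\ i < n, L i & envies f i a]) (envied f L a).
Proof.
apply: (iffP hasP) => [[i]|[i [ni Li e]]].
  by rewrite mem_iota /= => ni /andP[Li e]; exists i.
by exists i; rewrite ?mem_iota ?Li.
Qed.

Lemma worth_ext f g i a : (forall j, j < m -> g j = f j) -> worth g i a = worth f i a.
Proof. by move=> e; apply: eq_bigr => j _; rewrite e. Qed.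

Lemma worth_le f i a : worth f i a <= m.
Proof.
rewrite -[X in _ <= X]card_ord -sum1_card leq_sum // => j _.
by case: (_ && _).
Qed.

Lemma worth_place f j c i a : j < m -> f j != a ->
  worth (place f j c) i a = worth f i a + (like i j && (c == a)).
Proof.
move=> jm fj; rewrite /worth (bigD1 (Ordinal jm)) //= [in RHS](bigD1 (Ordinal jm)) //=.
rewrite /place eqxx (negPf fj) andbF add0n addnC; congr (_ + _).
by apply: eq_bigr => k kj; have /negPf -> : (k : nat) != j by [].
Qed.

Lemma acyclic_ext f g : (forall j, j < m -> g j = f j) -> acyclic f -> acyclic g.
Proof.
move=> e af W cW; apply: af => x /cW[xn [y Wy]]; rewrite /envies !(worth_ext _ _ e).
by move=> h; split=> //; exists y.
Qed.

(** Otherwise at most one agent [s] is valid, and it is not in [L]; put [s = l] if there is none.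
    Every agent other than [l] and [s] is then envied by a member of [L], which is neither [l] nor
    [s]. So these agents form an envy-closed set, nonempty because there are three agents. *)
Lemma good_of_content f l L : 2 < n -> acyclic f -> (L l -> l < n -> content f l) ->
  good f l L.
Proof.
move=> n3 af hl.
pose s := if has (valid f l L) (iota 0 n)
  then nth 0 (iota 0 n) (find (valid f l L) (iota 0 n)) else l.
have hs a : valid f l L a -> valid f l L s.
  move=> va; have h : has (valid f l L) (iota 0 n).
    by apply/hasP; exists a => //; rewrite mem_iota; case/andP: va.
  by rewrite /s h nth_find.
have [Ls|Ls] := boolP ((valid f l L s) && L s).
  by left; exists s; case/andP: Ls.
have [|no] := boolP (has (fun a => valid f l L a && (a != s)) (iota 0 n)).
  case/hasP => a _ /andP[va as_]; right; exists a, s; split=> //; exact: hs va.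
have cW : envy_closed f (fun x => [&& x < n, x != l & x != s]).
  move=> x /and3P[xn xl xs]; split=> //.
  have : ~~ valid f l L x.
    apply: contra no => vx; apply/hasP; exists x; rewrite ?mem_iota ?vx //.
  rewrite /valid xn xl /= negbK => /enviedP[i [ni Li e]].
  exists i => //; rewrite ni /=; apply/andP; split.
    apply/eqP => il; move: e; rewrite /envies ltnNge.
    by rewrite il in Li ni *; rewrite (hl Li ni _ xn).
  apply/eqP => is_; have [vs|vs] := boolP (valid f l L s).
    by move: Ls; rewrite vs -is_ Li.
  have sl : s = l.
    rewrite /s; case: ifP => // /hasP[a _ /hs]; by rewrite (negPf vs).
  move: e; rewrite /envies ltnNge.
  by rewrite is_ sl in Li ni *; rewrite (hl Li ni _ xn).
have := af _ cW.
(* One of the agents 0, 1, 2 differs from both [l] and [s]. *)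
case: (eqVneq 0 l) => [l0|l0]; last case: (eqVneq 0 s) => [s0|s0].
- case: (eqVneq 1 s) => [s1|s1].
    by move/(_ 2); rewrite n3 -l0 -s1.
  by move/(_ 1); rewrite s1 -l0 (ltn_trans _ n3).
- case: (eqVneq 1 l) => [l1|l1].
    by move/(_ 2); rewrite n3 -l1 -s0.
  by move/(_ 1); rewrite l1 -s0 (ltn_trans _ n3).
- by move/(_ 0); rewrite l0 s0 (ltn_trans _ n3).
Qed.

(** [L] and [L'] are the agents who like the current and the next item. The last alternative records
    that no valid agent passes the lookahead test, so that an arbitrary valid one was taken. *)
Definition choice f l L L' c :=
  valid f l L c /\
  (L c \/
   (forall a, valid f l L a -> ~~ L a) /\
   ((~~ L' c || envied f L' c) \/
    forall a, valid f l L a -> L' a && ~~ envied f L' a)).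

Lemma envy_bounded_place f l j c : j < m -> n <= f j -> envy_bounded f ->
  valid f l (like^~ j) c -> envy_bounded (place f j c).
Proof.
move=> jm fj ef /and3P[cn _ vc] i a ni na.
have fa x : x < n -> f j != x by move=> xn; rewrite neq_ltn orbC (leq_trans xn).
rewrite !worth_place ?fa //; have := ef i a ni na.
have [<-|_] := eqVneq c a; last by rewrite andbF; lia.
rewrite andbT; case Lij: (like i j) => /=; last by lia.
have : ~~ envies f i c by apply: contra vc => e; apply/enviedP; exists i.
by rewrite /envies; lia.
Qed.

(** If a rotation took place, or [c] likes item [j] or dislikes the next one, [good_of_content]
    applies. Otherwise either [c] is envied by somebody liking the next item, and a failure of
    [good] would produce an envy-closed set around [c]; or all valid agents like the next item and
    are unenvied by its likers. In that case [good f] supplies a second valid agent, whose bundle is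
    unchanged, and this agent is valid for the next item and likes it. *)
Lemma good_step f l j c L' g : 2 < n -> j < m -> n <= f j ->
  envy_bounded f -> acyclic f -> good f l (like^~ j) ->
  choice f l (like^~ j) L' c -> acyclic g ->
  (forall k, k < m -> g k = place f j c k) \/ content g (g j) ->
  good g (g j) L'.
Proof.
move=> n3 jm fj ef af gf [vc ch] ag [gE|cg]; last by apply: good_of_content.
have fa x : x < n -> f j != x by move=> xn; rewrite neq_ltn orbC (leq_trans xn).
have gj : g j = c by rewrite gE // /place eqxx.
have cn : c < n by case/and3P: vc.
have gw i a : a < n -> worth g i a = worth f i a + (like i j && (c == a)).
  by move=> an; rewrite (worth_ext _ _ gE) worth_place ?fa.
case: ch => [Lc|[nL ch]].
  apply: good_of_content => //; rewrite gj => _ _ a an; rewrite !gw // eqxx Lc /=.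
  by have [->//|_] := eqVneq c a; have := ef c a cn an; lia.
have [L'c|L'c] := boolP (L' c); last first.
  by apply: good_of_content => //; rewrite gj (negPf L'c).
have /negPf Lc := nL c vc.
case: ch => [|hv].
  rewrite L'c /= => ec.
  (* Excluded middle for [good], obtained constructively from bounded searches. *)
  have [//|ng] : good g (g j) L' \/ ~ good g (g j) L'.
    pose V (a : nat) := valid g (g j) L' a.
    have [/hasP[a _ /andP[]]|n1] := boolP (has (fun a => V a && L' a) (iota 0 n)).
      by left; left; exists a.
    have [/hasP[a _ /hasP[b _ /and3P[]]]|n2] :=
      boolP (has (fun a : nat => has (fun b : nat => [&& V a, V b & a != b])
        (iota 0 n)) (iota 0 n)).
      by left; right; exists a, b.
    have Vn a : V a -> a \in iota 0 n by rewrite mem_iota => /and3P[].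
    right; case=> [[a va La]|[a [b [va vb ab]]]].
      by case/hasP: n1; exists a; [apply: Vn|rewrite /V va].
    case/hasP: n2; exists a; first exact: Vn.
    by apply/hasP; exists b; [apply: Vn|rewrite /V va vb].
  (* As [good] fails, no liker of the next item is valid, so these agents all lie in [W]. They envy
     every invalid agent other than [c], and one of them envied [c] even before its bundle grew. *)
  pose W x := [&& x < n & ~~ valid g (g j) L' x || (x == c)].
  have cW : envy_closed g W.
    have envW i x : i < n -> L' i -> envies g i x -> exists2 y, W y & envies g y x.
      move=> ni Li e; exists i => //; rewrite /W ni /=; apply/orP; left.
      by apply/negP => vi; apply: ng; left; exists i.
    move=> x /andP[xn /orP[|/eqP ->]].
      have [->|xc] := eqVneq x c; last first.
        rewrite /valid gj xn xc /= negbK => /enviedP[i [ni Li e]]; split=> //.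
        exact: envW e.
      move=> _; case/enviedP: ec => i [ni Li e]; split=> //; apply: (envW i) => //.
      move: e; rewrite /envies !gw // eqxx andbT.
      by case: eqP => [<-|_]; rewrite ?Lc ?andbF //; lia.
    case/enviedP: ec => i [ni Li e]; split=> //; apply: (envW i) => //.
    move: e; rewrite /envies !gw // eqxx andbT.
    by case: eqP => [<-|_]; rewrite ?Lc ?andbF //; lia.
  by move: (ag _ cW c); rewrite /W cn eqxx orbT.
case: gf => [[a va La]|[a [b [va vb ab]]]]; first by rewrite (negPf (nL a va)) in La.
suff main d : valid f l (like^~ j) d -> d != c -> good g (g j) L'.
  by have [ac|ac] := eqVneq a c; [apply: (main b)|apply: (main a)]; rewrite // -ac eq_sym.
move=> vd dc; have /andP[Ld ed] := hv d vd; have dn : d < n by case/and3P: vd.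
left; exists d; rewrite // /valid dn gj dc; apply: contra ed.
case/enviedP => i [ni Li]; rewrite /envies !gw // => e; apply/enviedP; exists i; split=> //.
by move: e; rewrite /envies [c == d]eq_sym (negPf dc) andbF; lia.
Qed.

(** * Rotating bundles: the bundle of [x] passes to [r x] *)

Definition rotation f g := exists (C : pred nat) (r : nat -> nat),
  [/\ exists x, C x, envy_closed f C,
      {in gtn n &, injective r} /\ (forall x, (r x < n) = (x < n)),
      forall j, j < m -> g j = r (f j)
    & forall x, x < n -> if C x then envies f (r x) x else r x == x].

Lemma rotation_worth f g (r : nat -> nat) i a : {in gtn n &, injective r} ->
  (forall x, (r x < n) = (x < n)) ->
  (forall j, j < m -> g j = r (f j)) -> a < n -> worth g i (r a) = worth f i a.
Proof.
move=> ri rn gE an; apply: eq_bigr => j _; rewrite gE //; congr (nat_of_bool (_ && _)).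
apply/eqP/eqP => [e|-> //]; apply: ri => //.
by rewrite inE -rn e rn.
Qed.

Lemma surj_of_inj (r : nat -> nat) : {in gtn n &, injective r} ->
  (forall x, (r x < n) = (x < n)) -> forall a, a < n -> exists2 b, b < n & r b = a.
Proof.
move=> ri rn a an.
have rP (x : 'I_n) : r x < n by rewrite rn.
pose R (x : 'I_n) := Ordinal (rP x).
have Ri : injective R.
  by move=> x y /(congr1 val) /= h; apply/val_inj/(ri _ _ _ _ h); apply: ltn_ord.
have [/= R' _ R'K] := injF_bij Ri.
exists (R' (Ordinal an)) => //.
by rewrite -[RHS]/(val (Ordinal an)) -[in RHS](R'K (Ordinal an)).
Qed.

(** Bundles are only relabelled, and nobody's own bundle loses worth. Whoever takes over an envied
    bundle gains, and under [envy_bounded] then owns a bundle of the largest worth to them, hence is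
    content. *)
Lemma rotation_facts f g : rotation f g -> envy_bounded f ->
  [/\ envy_bounded g,
      \sum_(i < n) worth f i i < \sum_(i < n) worth g i i,
      forall j, j < m -> (g j < n) = (f j < n),
      forall j k, j < m -> k < m -> f j < n -> f k < n -> g j = g k -> f j = f k
    & forall j, j < m -> f j < n -> content f (f j) -> content g (g j)].
Proof.
move=> [C [r [[x0 Cx0] cC [ri rn] gE rE]]] ef.
have wr i a := @rotation_worth f g r i a ri rn gE.
have sr := surj_of_inj ri rn.
have up x : x < n -> worth f (r x) (r x) <= worth g (r x) (r x).
  move=> xn; rewrite wr //; have := rE x xn; case: (C x) => [|/eqP ->] //.
  by rewrite /envies; lia.
have upr i : i < n -> worth f i i <= worth g i i.
  by move=> ni; have [b bn <-] := sr i ni; apply: up.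
split.
- move=> i a ni na; have [b bn <-] := sr a na; rewrite wr //.
  by have := ef i b ni bn; have := upr i ni; lia.
- have x0n : x0 < n by have [] := cC _ Cx0.
  have rx0 : r x0 < n by rewrite rn.
  rewrite (bigD1 (Ordinal rx0)) //= [X in _ < X](bigD1 (Ordinal rx0)) //= -addSn leq_add //.
    by have := rE x0 x0n; rewrite Cx0 wr.
  by rewrite leq_sum // => i _; apply: upr.
- by move=> j jm; rewrite gE // rn.
- by move=> j k jm km fj fk; rewrite !gE //; apply: ri.
- move=> j jm fj cj a na; have [b bn <-] := sr a na; rewrite gE // !wr //.
  have := rE _ fj; case: (C (f j)) => [e|/eqP ->]; last exact: cj.
  by have := ef (r (f j)) b; rewrite rn => /(_ fj bn); rewrite /envies in e; lia.
Qed.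

(* Envy was acyclic before item j was given to c, so every cycle contains c,  *)
(* and the bundle of c moves to an agent who envied it.                       *)
Lemma rotation_moved f g j c : j < m -> n <= f j -> c < n -> acyclic f ->
  envy_bounded (place f j c) -> rotation (place f j c) g -> content g (g j).
Proof.
move=> jm fj cn af ef [C [r [[x0 Cx0] cC [ri rn] gE rE]]].
have fa x : x < n -> f j != x by move=> xn; rewrite neq_ltn orbC (leq_trans xn).
have wr i a := @rotation_worth (place f j c) g r i a ri rn gE.
have gj : g j = r c by rewrite gE // /place eqxx.
have Cc : C c.
  apply/negPn/negP => nC; have /negP[] : ~~ C x0; last by [].
  apply: (af C) => x Cx; have [xn [y Cy e]] := cC x Cx; split=> //; exists y => //.
  have yn : y < n by have [] := cC y Cy.
  have [xc yc] : x <> c /\ y <> c by split=> ec; rewrite ec in Cx Cy; rewrite ?Cx ?Cy in nC.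
  move: e; rewrite /envies !worth_place ?fa //.
  by have /eqP/negPf := nesym xc; have /eqP/negPf := nesym yc => -> ->; rewrite !andbF !addn0.
move=> a na; have [b bn <-] := surj_of_inj ri rn na; rewrite gj !wr //.
have := rE c cn; rewrite Cc => e.
by have := ef (r c) b; rewrite rn => /(_ cn bn); rewrite /envies in e; lia.
Qed.

(** No bundle is worth more than [m] to anyone, so a single envious agent would push the total below
    [n * m]. *)
Lemma acyclic_of_max f : n * m <= \sum_(i < n) worth f i i -> acyclic f.
Proof.
move=> h W cW x; apply/negP => /cW[xn [y /cW[yn _]]].
rewrite /envies => e; have xm := worth_le f y x.
have : \sum_(i < n) worth f i i < \sum_(i < n) m.
  rewrite (bigD1 (Ordinal yn)) //= [X in _ < X](bigD1 (Ordinal yn)) //= -addSn leq_add //.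
    by apply: leq_trans e xm.
  by rewrite leq_sum // => i _; apply: worth_le.
by rewrite sum_nat_const card_ord; lia.
Qed.

(* Possible owners g after t rotations starting from f; j is the item that    *)
(* was given out last.  Each rotation increases the total worth, which is at  *)
(* most n * m, so that n * m rounds make envy acyclic.                        *)
Definition untangled f j t g :=
  [/\ envy_bounded g,
      forall k, k < m -> (g k < n) = (f k < n),
      forall k k', k < m -> k' < m -> f k < n -> f k' < n -> g k = g k' -> f k = f k',
      (forall k, k < m -> g k = f k) \/ content g (g j)
    & acyclic g \/ t <= \sum_(i < n) worth g i i].

Lemma untangled0 f j : envy_bounded f -> untangled f j 0 f.
Proof. by move=> ef; split=> //; [left|right]. Qed.

Lemma envy_bounded_ext f g : (forall j, j < m -> g j = f j) -> envy_bounded f -> envy_bounded g.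
Proof. by move=> e ef i a ni na; rewrite !(worth_ext _ _ e); apply: ef. Qed.

Lemma content_ext f g i : (forall j, j < m -> g j = f j) -> content f i -> content g i.
Proof. by move=> e ef a na; rewrite !(worth_ext _ _ e); apply: ef. Qed.

(** The first rotation makes the owner of [j] content by [rotation_moved], and later ones preserve
    this by [rotation_facts]. A round without rotation is possible only when envy is already
    acyclic. *)
Lemma untangledS f j c t g h : j < m -> n <= f j -> c < n -> acyclic f ->
  untangled (place f j c) j t g ->
  (acyclic g /\ forall k, k < m -> h k = g k) \/ rotation g h ->
  untangled (place f j c) j t.+1 h.
Proof.
move=> jm fj cn af [eg gn gi gc ga] [[ag hE]|rot].
  split.
  - exact: envy_bounded_ext hE eg.
  - by move=> k km; rewrite hE ?gn.
  - by move=> k k' km km'; rewrite !hE //; apply: gi.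
  - case: gc => [gE|cg]; [left=> k km|right]; first by rewrite hE ?gE.
    by rewrite hE //; apply: content_ext cg.
  - by left; apply: acyclic_ext hE ag.
have [eh hs hn hi hc] := rotation_facts rot eg.
have pj : place f j c j = c by rewrite /place eqxx.
split=> //.
- by move=> k km; rewrite hn ?gn.
- move=> k k' km km' fk fk' hk; apply: gi => //; apply: hi; rewrite ?gn //.
- right; case: gc => [gE|cg]; last by apply: hc => //; rewrite gn // pj.
  apply: (@rotation_moved f h j c) => //.
    by apply: envy_bounded_ext eg => k km; rewrite gE.
  have wE i a : worth (place f j c) i a = worth g i a by apply: worth_ext => k km; rewrite gE.
  case: rot => C [r [Cx cC rr hE rE]]; exists C, r; split=> //.
  - by move=> x /cC[xn [y Cy e]]; split=> //; exists y => //; rewrite /envies !wE.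
  - by move=> k km; rewrite hE ?gE.
  - by move=> x xn; rewrite /envies !wE; apply: rE.
- case: ga => [ag|]; last by right; lia.
  case: rot => C [r [[x Cx] cC _ _ _]].
  by move: (ag C cC x); rewrite Cx.
Qed.

(* The r-th stage of removing the agents whom no remaining agent envies.      *)
Fixpoint alive f r x :=
  (x < n) && (if r is r'.+1 then has (fun y => alive f r' y && envies f y x) (iota 0 n) else true).

Lemma alive_lt f r x : alive f r x -> x < n.
Proof. by case: r => [|r] /andP[]. Qed.

Lemma aliveS f r x :
  alive f r.+1 x = (x < n) && has (fun y => alive f r y && envies f y x) (iota 0 n).
Proof. by []. Qed.

Lemma alive_decr f r x : alive f r.+1 x -> alive f r x.
Proof.
elim: r x => [|r IH] x; rewrite aliveS => /andP[xn]; first by rewrite /= xn.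
case/hasP => y yn /andP[ay e]; rewrite aliveS xn.
by apply/hasP; exists y => //; rewrite e IH.
Qed.

(** With [alive_closed], this makes [alive f n] the largest envy-closed set; it is empty exactly
    when envy is acyclic. *)
Lemma alive_sub f (W : pred nat) r x : envy_closed f W -> W x -> alive f r x.
Proof.
move=> cW; elim: r x => [|r IH] x Wx; have [xn [y Wy e]] := cW x Wx; first by rewrite /= xn.
rewrite aliveS xn; apply/hasP; exists y; last by rewrite IH.
by rewrite mem_iota; have [] := cW y Wy.
Qed.

(** The stages decrease and stay constant once two consecutive ones agree. Each strict decrease
    costs an agent, so [n] stages suffice. *)
Lemma alive_closed f : envy_closed f (alive f n).
Proof.
pose U r := [set x : 'I_n | alive f r x].
have US r : U r.+1 \subset U r.
  by apply/subsetP => x; rewrite !inE; apply: alive_decr.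
have Ustep r : U r.+1 = U r -> U r.+2 = U r.+1.
  move=> e; have aE y : y < n -> alive f r.+1 y = alive f r y.
    by move=> yn; have /setP/(_ (Ordinal yn)) := e; rewrite !inE.
  apply/setP => x; rewrite !inE [LHS]aliveS [RHS]aliveS; congr (_ && _).
  by apply: eq_in_has => y; rewrite mem_iota => yn; rewrite aE.
have Ucard r : U r.+1 = U r \/ #|U r| + r <= n.
  elim: r => [|r [e|c]]; first by right; rewrite addn0 -[X in _ <= X]card_ord max_card.
    by left; apply: Ustep.
  have [e|ne] := eqVneq (U r.+1) (U r); first by left; apply: Ustep.
  right; have : U r.+1 \proper U r by rewrite properEneq ne US.
  by move/proper_card; lia.
have e : U n.+1 = U n.
  have [//|] := Ucard n; rewrite -[X in _ <= X]add0n leq_add2r leqn0 cards_eq0 => /eqP e.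
  by apply/eqP; rewrite eqEsubset US e sub0set.
move=> x ax; have xn := alive_lt ax; split=> //.
have : alive f n.+1 x by have /setP/(_ (Ordinal xn)) := e; rewrite !inE ax.
by rewrite aliveS => /andP[_ /hasP[y _ /andP[ay ey]]]; exists y.
Qed.

End Envy.

(** The walk repeats a value within as many steps as its orbit has elements, which is at most
    [#|T|]; from then on it is on the cycle. *)
Lemma iter_card_periodic (T : finType) (p : T -> T) y :
  exists k, iter k.+1 p (iter #|T| p y) = iter #|T| p y.
Proof.
have /loopingP/(_ (fingraph.order p y)) := looping_order p y.
case/trajectP => i ilt e.
exists (fingraph.order p y - i).-1.
have oT : fingraph.order p y <= #|T| by apply: max_card.
rewrite prednK ?subn_gt0 // -iterD.
have -> : fingraph.order p y - i + #|T| = (#|T| - i) + fingraph.order p y by lia.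
by rewrite iterD e -iterD; congr (iter _ p y); lia.
Qed.

(* The walk p reaches a cycle within n steps, and n further steps traverse    *)
(* this cycle.                                                                *)
Section Shift.
Variables (n : nat) (p : nat -> nat) (U : pred nat) (y : nat).
Hypotheses (Un : forall x, U x -> x < n) (Up : forall x, U x -> U (p x)) (Uy : U y).
Let z := iter n p y.
Let C := traject p z n.
Let r x := if x \in C then p x else x.

(** Transported to ['I_n], the set [C] is the orbit of a periodic point, since [n] terms cover any
    orbit. The map [p] is injective on it and preserves it, and [r] is the identity elsewhere. *)
Lemma shift_facts :
  [/\ forall x, x \in C -> U x, z \in C, forall x, x \in C -> p x \in C
    & {in gtn n &, injective r}].
Proof.
have Uit k : U (iter k p y) by elim: k => //= k; apply: Up.
have n0 : 0 < n by apply: leq_ltn_trans (Un Uy).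
have CU x : x \in C -> U x by case/trajectP => i _ ->; rewrite /z -iterD Uit.
pose P (x : 'I_n) := insubd x (p x).
have PE (x : 'I_n) : U x -> val (P x) = p x.
  by move=> Ux; rewrite /P val_insubd Un // Up.
pose y' := Ordinal (Un Uy).
have itE k : val (iter k P y') = iter k p y.
  by elim: k => //= k IH; rewrite PE IH.
pose z' := iter n P y'.
have zE k : val (iter k P z') = iter k p z by rewrite /z' /z -!iterD itE.
have [k kz] : exists k, iter k.+1 P z' = z'.
  by have := iter_card_periodic P y'; rewrite card_ord.
have Pinj : {in orbit P z' &, injective P}.
  by have [h _] := orbitPcycle (f := P) (x := z') 3 5; apply: h; exists k.
have CE (x : 'I_n) : (val x \in C) = (x \in orbit P z').
  rewrite -fconnect_orbit; apply/trajectP/idP => [[i _]|].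
    by rewrite -zE => /val_inj ->; apply: fconnect_iter.
  move=> h; exists (findex P z' x); last by rewrite -zE iter_findex.
  by apply: leq_trans (findex_max h) _; rewrite -[X in _ <= X](card_ord n) max_card.
have Cp x : x \in C -> p x \in C.
  move=> xC; have Ux := CU x xC.
  have xn := Un Ux; rewrite -[x]/(val (Ordinal xn)) -PE // CE -fconnect_orbit.
  by rewrite -[x]/(val (Ordinal xn)) CE -fconnect_orbit in xC; apply: connect_trans xC (fconnect1 _ _).
split=> //; first by apply/trajectP; exists 0.
move=> a b an bn; rewrite /r; case: ifPn => aC; case: ifPn => bC.
- have PA : val (P (Ordinal an)) = p a by rewrite PE //; apply: CU.
  have PB : val (P (Ordinal bn)) = p b by rewrite PE //; apply: CU.
  rewrite -PA -PB => /val_inj /Pinj; rewrite -!CE => h.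
  by have [] := h aC bC.
- by move=> e; rewrite -e Cp in bC.
- by move=> e; rewrite e Cp in aC.
- by [].
Qed.
End Shift.

(** * The program and its correctness *)

(** The maps [r] and [c] locate the sums, so that this serves both one-dimensional arrays and the
    single rows of [run_table]. *)
Lemma run_sums (F : nat -> nat -> nat) (r c : nat -> nat) (T w b z bz : nat) e1 e2 e s :
  uniq [:: T; w; z] -> bz \notin [:: T; w; z] ->
  (forall i k, r i = r k -> c i = c k -> i = k) ->
  (forall s' i, (forall a p q, a \notin [:: T; w; z] -> s' a p q = s a p q) ->
     s' w 0 0 = i -> eval s' e1 = r i /\ eval s' e2 = c i) ->
  (forall s' i k, (forall a p q, a \notin [:: T; w; z] -> s' a p q = s a p q) ->
     s' w 0 0 = i -> s' z 0 0 = k -> i < s b 0 0 -> k < s bz 0 0 -> eval s' e = F i k) ->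
  let s1 := run (BFor w b (summation T e1 e2 z bz e)) s in
  (forall i, i < s b 0 0 -> s1 T (r i) (c i) = \sum_(k < s bz 0 0) F i k) /\
  (forall p q, (forall i, (p, q) != (r i, c i)) -> s1 T p q = s T p q).
Proof.
rewrite /= !inE !negb_or andbT => /andP[/andP[Tw Tz] wz] /and3P[bT bw bzz] inj H1 H2.
pose P i (s' : memory) :=
  (forall k, k < i -> s' T (r k) (c k) = \sum_(k' < s bz 0 0) F k k') /\
  (forall p q, (forall k, (p, q) != (r k, c k)) -> s' T p q = s T p q).
apply: (@run_for P w b (summation T e1 e2 z bz e) s).
- by rewrite /= (negPf wz) eq_sym (negPf Tw).
- by split=> // p q _; rewrite update_array.
- move=> i s' ib wi fr [h1 h2].
  have fr' a p q : a \notin [:: T; w; z] -> s' a p q = s a p q.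
    by rewrite !inE !negb_or => /and3P[aT aw az]; rewrite fr //= !negb_or aT az.
  have sbz : s' bz 0 0 = s bz 0 0 by rewrite fr' // !inE !negb_or bT bw.
  have frS s2 : (forall a p q, a != T -> a != z -> s2 a p q = s' a p q) ->
    forall a p q, a \notin [:: T; w; z] -> s2 a p q = s a p q.
    move=> h a p q; rewrite !inE !negb_or => /and3P[aT aw az].
    by rewrite h // fr' // !inE !negb_or aT aw.
  have [e1i e2i] := H1 s' i fr' wi.
  have [||||s2 k h zk|f1 f2] := @run_summation (F i) T e1 e2 z bz e (r i) (c i) s' => //.
  + by rewrite eq_sym.
  + have wi2 : s2 w 0 0 = i by rewrite h // eq_sym.
    rewrite sbz => kb; have [-> ->] := H1 s2 i (frS s2 h) wi2.
    by split=> //; apply: H2 => //; apply: frS.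
  rewrite sbz in f1; split=> [k ki|p q pq]; rewrite update_array //.
    have [->|ki'] := eqVneq k i; first exact: f1.
    rewrite f2; first by apply: h1; lia.
    apply: contra ki'; rewrite xpair_eqE => /andP[/eqP ? /eqP ?].
    by apply/eqP; apply: inj.
  by rewrite f2 ?h2.
Qed.

Lemma run_table (F : nat -> nat -> nat -> nat) (T x bx y b z bz : nat) e s :
  uniq [:: T; x; y; z] -> b \notin [:: T; x; y; z] -> bz \notin [:: T; x; y; z] ->
  (forall s' i j k, (forall a p q, a \notin [:: T; x; y; z] -> s' a p q = s a p q) ->
     s' x 0 0 = i -> s' y 0 0 = j -> s' z 0 0 = k ->
     i < s bx 0 0 -> j < s b 0 0 -> k < s bz 0 0 -> eval s' e = F i j k) ->
  let s1 := run (BFor x bx (BFor y b (summation T (var x) (var y) z bz e))) s in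
  forall i j, i < s bx 0 0 -> j < s b 0 0 -> s1 T i j = \sum_(k < s bz 0 0) F i j k.
Proof.
rewrite [uniq _]/= !inE !negb_or !andbT => /and3P[/and3P[Tx Ty Tz] /andP[xy xz] yz].
move=> /and4P[bT bx' by' bz'] /and4P[bzT bzx bzy bzz] H.
set body := BFor y b _.
pose P i (s' : memory) := forall i' j, i' < i -> j < s b 0 0 ->
  s' T i' j = \sum_(k < s bz 0 0) F i' j k.
apply: (@run_for P x bx body s) => //.
  by rewrite /= (negPf xy) (negPf xz) eq_sym (negPf Tx).
move=> i s' ib xi fr h.
have fr' a p q : a \notin [:: T; x; y; z] -> s' a p q = s a p q.
  by rewrite !inE !negb_or => /and4P[aT ax ay az]; rewrite fr //= !negb_or aT az ay.
have sbz : s' bz 0 0 = s bz 0 0 by rewrite fr' // !inE !negb_or bzT bzx bzy.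
have sb : s' b 0 0 = s b 0 0 by rewrite fr' // !inE !negb_or bT bx' by'.
have [|||s2 j h2 yj|s2 j k h2 yj zk|f1 f2] :=
  @run_sums (F i) (fun _ => i) id T y b z bz (var x) (var y) e s' => //.
- by rewrite /= !inE !negb_or Ty Tz yz.
- by rewrite !inE !negb_or bzT bzy.
- by rewrite /= yj h2 // !inE !negb_or [x == T]eq_sym Tx xy.
- rewrite sb sbz => jb kb; apply: H => //.
    move=> a p q; rewrite !inE !negb_or => /and4P[aT ax ay az].
    by rewrite h2 ?fr' // !inE !negb_or ?aT ?ax ?ay.
  by rewrite h2 // !inE !negb_or [x == T]eq_sym Tx xy.
rewrite sb sbz in f1.
move=> i' j i'i jb; rewrite update_array //.
have [->|ii] := eqVneq i' i; first exact: f1.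
rewrite f2; first by apply: h => //; lia.
by move=> k; rewrite xpair_eqE (negPf ii).
Qed.

(* Memory layout: 5 degree, 6 processing order, 7 visited items, 8 previous   *)
(* item, 9 next item of the order, 10 worth, 11 number of envious agents who  *)
(* like a given item, 12 chosen agent, 13 agents not yet excluded from all    *)
(* envy cycles, 14 number of their enviers, 15 some envier, 16 current agent  *)
(* of the walk, 17 relabelling of the owners, from 20 on loop counters.       *)
Definition order_block :=
  BSeq (BFor 20 1 (summation 5 (var 20) (Const 0) 21 1 (eNot (eNot (Read 3 (var 20) (var 21))))))
 (BSeq (BWrite 8 (Const 0) (Const 0) (var 1))
 (BFor 23 1
   (BSeq (BWrite 9 (Const 0) (Const 0) (var 1))
   (BSeq (search 9 (Const 0) (Const 0) 21 1
            (eAnd (eNot (Read 7 (var 21) (Const 0)))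
                  (eNot (Sub (Read 5 (var 21) (Const 0)) (Const 1)))))
   (BSeq (search 9 (Const 0) (Const 0) 21 1
            (eAnd (eNot (Read 7 (var 21) (Const 0))) (Read 3 (var 8) (var 21))))
   (BSeq (BWrite 6 (var 23) (Const 0) (var 9))
   (BSeq (BWrite 7 (var 9) (Const 0) (Const 1))
         (BWrite 8 (Const 0) (Const 0) (var 9))))))))).

Definition worth_block :=
  BFor 20 0 (BFor 21 0 (summation 10 (var 20) (var 21) 22 1
    (eAnd (Read 2 (var 20) (var 22)) (eEq (Read 4 (var 22) (Const 0)) (var 21))))).

Definition eEnvy z x := Sub (Read 10 z x) (Read 10 z z).

Definition envied_block :=
  BFor 20 0 (BFor 21 1 (summation 11 (var 20) (var 21) 22 0
    (eAnd (Read 2 (var 22) (var 21)) (eEnvy (var 22) (var 20))))).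

Definition eItem := Read 6 (var 23) (Const 0).
Definition eNext := Read 6 (Add (var 23) (Const 1)) (Const 0).
Definition eValid :=
  eAnd (eNot (Read 11 (var 22) eItem)) (eNot (eEq (var 22) (Read 4 (var 8) (Const 0)))).

(** Three searches into one cell in order of increasing priority: any valid agent, one passing the
    lookahead test, one who likes the item. *)
Definition choice_block :=
  BSeq worth_block
 (BSeq envied_block
 (BSeq (BWrite 12 (Const 0) (Const 0) (var 0))
 (BSeq (search 12 (Const 0) (Const 0) 22 0 eValid)
 (BSeq (search 12 (Const 0) (Const 0) 22 0
          (eAnd eValid (Add (eNot (Read 2 (var 22) eNext)) (Read 11 (var 22) eNext))))
       (search 12 (Const 0) (Const 0) 22 0 (eAnd eValid (Read 2 (var 22) eItem))))))).

Definition eEnvious := eAnd (Read 13 (var 21) (Const 0)) (eEnvy (var 21) (var 20)).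

(** Counts are collected in array 14 so that a stage reads only the previous one. After the copy
    array 13 holds counts, and nonzero means not excluded. *)
Definition alive_block :=
  BSeq (tabulate 13 20 0 (Const 1))
       (BFor 26 0
          (BSeq (BFor 20 0 (summation 14 (var 20) (Const 0) 21 0 eEnvious))
                (tabulate 13 20 0 (Read 14 (var 20) (Const 0))))).

(** The dummy agent [n] becomes its own envier. If there is no envy cycle, the walk starts and stays
    there, and the rotation changes nothing. *)
Definition envier_block :=
  BSeq (BFor 20 0 (BSeq (BWrite 15 (var 20) (Const 0) (var 0))
                        (search 15 (var 20) (Const 0) 21 0 eEnvious)))
       (BWrite 15 (var 0) (Const 0) (var 0)).

Definition walk_block :=
  BSeq (BWrite 16 (Const 0) (Const 0) (var 0))
 (BSeq (search 16 (Const 0) (Const 0) 21 0 (Read 13 (var 21) (Const 0)))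
       (BFor 26 0 (BWrite 16 (Const 0) (Const 0) (Read 15 (var 16) (Const 0))))).

(** The [n] steps may go round the cycle several times, always rewriting the same values. Entry [n]
    is fixed, so unallocated items remain unallocated. *)
Definition relabel_block :=
  BSeq (tabulate 17 20 0 (var 20))
 (BSeq (BWrite 17 (var 0) (Const 0) (var 0))
 (BSeq (BFor 26 0 (BSeq (BWrite 17 (var 16) (Const 0) (Read 15 (var 16) (Const 0)))
                        (BWrite 16 (Const 0) (Const 0) (Read 15 (var 16) (Const 0)))))
       (tabulate 4 20 1 (Read 17 (Read 4 (var 20) (Const 0)) (Const 0))))).

Definition rotation_block :=
  BSeq worth_block (BSeq alive_block (BSeq envier_block (BSeq walk_block relabel_block))).

Definition main_block :=
  BSeq order_block
 (BSeq (tabulate 4 20 1 (var 0))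
       (BFor 23 1
          (BSeq choice_block
          (BSeq (BWrite 4 eItem (Const 0) (var 12))
          (BSeq (BFor 24 0 (BFor 25 1 rotation_block))
                (BWrite 8 (Const 0) (Const 0) eItem)))))).

Lemma main_block_well_formed : well_formed main_block.
Proof. by []. Qed.

(** * Correctness of the envy tables and of the chosen recipient *)

Definition likes (s : memory) i j := s 2 i j != 0.
Definition owner (s : memory) j := s 4 j 0.

Lemma run_worth s like i a : (forall i j, likes s i j = like i j) ->
  i < s 0 0 0 -> a < s 0 0 0 ->
  run worth_block s 10 i a = worth (s 1 0 0) like (owner s) i a.
Proof.
move=> likeE hi ha; rewrite /worth_block.
rewrite (@run_table (fun i a j => like i j && (owner s j == a)) 10 20 0 21 0 22 1) //.
move=> s' i' j' k fr xi yj zk _ _ _; rewrite eval_and eval_eq /= xi yj zk.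
by rewrite !fr // eqb0 negbK -likeE.
Qed.

Lemma sum_bool_neq0 (b : pred nat) N : (\sum_(k < N) b k != 0) = has b (iota 0 N).
Proof.
rewrite -lt0n; apply/idP/hasP => [|[k]].
  case: (pickP (fun k : 'I_N => b k)) => [k bk _|h].
    by exists (val k) => //; rewrite mem_iota /=.
  by rewrite big1 // => k _; rewrite h.
by rewrite mem_iota /= => kN bk; rewrite (bigD1 (Ordinal kN)) //= bk.
Qed.

Lemma run_envied s like f :
  (forall i j, likes s i j = like i j) ->
  (forall i a, i < s 0 0 0 -> a < s 0 0 0 -> s 10 i a = worth (s 1 0 0) like f i a) ->
  forall a j, a < s 0 0 0 -> j < s 1 0 0 ->
  (run envied_block s 11 a j != 0) = envied (s 0 0 0) (s 1 0 0) like f (like ^~ j) a.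
Proof.
move=> likeE H a j ha hj; rewrite /envied_block.
rewrite (@run_table (fun a j i => like i j && envies (s 1 0 0) like f i a)
  11 20 0 21 1 22 0) //.
  exact: (sum_bool_neq0 (fun i => like i j && envies (s 1 0 0) like f i a)).
move=> s' i' j' k fr xi yj zk ib _ kb; rewrite eval_and /= xi yj zk.
by rewrite !fr // -likeE /envies -!H // subn_eq0 -ltnNge.
Qed.

Lemma run_choice s like :
  let n := s 0 0 0 in let m := s 1 0 0 in
  let j := s 6 (s 23 0 0) 0 in let j' := s 6 (s 23 0 0).+1 0 in
  let f := owner s in let l := f (s 8 0 0) in
  let c := run choice_block s 12 0 0 in
  (forall i k, likes s i k = like i k) -> j < m -> good n m like f l (like ^~ j) ->
  valid n m like f l (like ^~ j) c /\
  (j' < m -> choice n m like f l (like ^~ j) (like ^~ j') c).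
Proof.
move=> n m j j' f l c likeE jm gd.
set L := like^~ j in gd *; set L' := like^~ j'.
pose s2 := run envied_block (run worth_block s).
have fr2 a p q : ~~ writes a (BSeq worth_block envied_block) -> s2 a p q = s a p q.
  rewrite [writes _ _]/= => h.
  by rewrite /s2 !run_frame //; apply: contra h => /= h; rewrite h ?orbT.
have env a k : a < n -> k < m -> (s2 11 a k != 0) = envied n m like f (like^~ k) a.
  move=> an km; rewrite /s2.
  have := @run_envied (run worth_block s) like f; rewrite !(run_frame (p := worth_block)) //.
  apply=> // [i q|i b ni nb]; first by rewrite /likes run_frame // -likeE.
  exact: run_worth.
pose s3 := update s2 12 0 0 n.
have s3E : update s2 12 (eval s2 (Const 0)) (eval s2 (Const 0)) (eval s2 (var 0)) = s3.
  by rewrite /s3 /= fr2.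
pose s4 := run (search 12 (Const 0) (Const 0) 22 0 eValid) s3.
pose s5 := run (search 12 (Const 0) (Const 0) 22 0
          (eAnd eValid (Add (eNot (Read 2 (var 22) eNext)) (Read 11 (var 22) eNext)))) s4.
pose s6 := run (search 12 (Const 0) (Const 0) 22 0 (eAnd eValid (Read 2 (var 22) eItem))) s5.
have -> : c = s6 12 0 0 by rewrite /c /s6 /s5 /s4 -s3E.
have fr3 a p q : a != 12 -> a != 22 -> s3 a p q = s2 a p q by move=> h _; rewrite /s3 update_array.
have fr4 a p q : a != 12 -> a != 22 -> s4 a p q = s2 a p q.
  by move=> h1 h2; rewrite /s4 run_frame ?fr3 //= negb_or h1 h2.
have fr5 a p q : a != 12 -> a != 22 -> s5 a p q = s2 a p q.
  by move=> h1 h2; rewrite /s5 run_frame ?fr4 //= negb_or h1 h2.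
pose V := valid n m like f l L.
have vE s' k : (forall a p q, a != 12 -> a != 22 -> s' a p q = s2 a p q) ->
    s' 22 0 0 = k -> k < n -> (eval s' eValid != 0) = V k.
  move=> fr zk kn; rewrite eval_and eval_not [eval _ (eNot (eEq _ _))]eval_not eval_eq /=.
  rewrite zk !fr // !(fr2 6, fr2 4, fr2 8, fr2 23) //.
  by rewrite /V /valid kn andbC -(env k j) //= !eqb0 -/j !negbK.
have [||h4 _] := @run_search V 12 (Const 0) (Const 0) 22 0 eValid 0 0 s3 => //.
  move=> s' k fr zk kn; split=> //; apply: vE zk _; last by rewrite fr3 ?fr2 in kn.
  by move=> a p q a1 a2; rewrite fr ?fr3.
(* Phrased with the stored count, because [j'] need not be an item and the table is known only for
   items. *)
pose Q k := ~~ L' k || (s2 11 k j' != 0).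
have [||h5 _] := @run_search (fun k => V k && Q k) 12
   (Const 0) (Const 0) 22 0
   (eAnd eValid (Add (eNot (Read 2 (var 22) eNext)) (Read 11 (var 22) eNext))) 0 0 s4 => //.
  move=> s' k fr zk; rewrite fr4 // fr2 // => kn; split=> //.
  have fr' a p q : a != 12 -> a != 22 -> s' a p q = s2 a p q by move=> a1 a2; rewrite fr ?fr4.
  rewrite eval_and (vE s' k) //= zk !fr' // !(fr2 6, fr2 2, fr2 23) // addn1 eqb0.
  rewrite addn_eq0 !negbK negb_and /Q /L' -likeE /likes -/j'.
  by case: (s 2 k j') => [|[|x]].
have [||h6 _] := @run_search (fun k => V k && L k) 12
   (Const 0) (Const 0) 22 0 (eAnd eValid (Read 2 (var 22) eItem)) 0 0 s5 => //.
  move=> s' k fr zk; rewrite fr5 // fr2 // => kn; split=> //.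
  have fr' a p q : a != 12 -> a != 22 -> s' a p q = s2 a p q by move=> a1 a2; rewrite fr ?fr5.
  by rewrite eval_and (vE s' k) //= zk !fr' // !(fr2 6, fr2 2, fr2 23) // eqb0 negbK /L -likeE.
rewrite -/s4 fr3 // fr2 // -/n in h4; rewrite -/s5 fr4 // fr2 // -/n in h5.
rewrite -/s6 fr5 // fr2 // -/n in h6.
have Vn a : V a -> a \in iota 0 n by rewrite mem_iota => /and3P[].
have [c0 vc0] : exists a, V a by case: gd => [[a va _]|[a [b [va _ _]]]]; exists a.
have {h4} v4 : V (s4 12 0 0).
  move: h4; rewrite ifT; first by case/andP.
  by apply/hasP; exists c0 => //; apply: Vn.
have chE d : V d -> (L d \/ (forall a, V a -> ~~ L a) /\ (Q d \/ forall a, V a -> ~~ Q a)) ->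
    V d /\ (j' < m -> choice n m like f l L L' d).
  move=> vd h; split=> // j'm; split=> //; case: h => [Ld|[nL h]]; [by left|right; split=> //].
  have QE a : V a -> Q a = ~~ L' a || envied n m like f L' a.
    by case/and3P => an _ _; rewrite /Q env.
  case: h => [h|h]; [left|right=> a va]; rewrite -?QE //.
  by have := h a va; rewrite QE // negb_or negbK.
move: h6; case: ifPn => [_ /andP[_ /andP[v6 l6]]|/hasPn n6 /eqP ->].
  by apply: chE => //; left.
have nl a : V a -> ~~ L a.
  by move=> va; have := n6 a (Vn a va); rewrite va.
move: h5; case: ifPn => [_ /andP[_ /andP[v5 l5]]|/hasPn n5 /eqP ->].
  by apply: chE => //; right; split=> //; left.
by apply: chE => //; right; split=> //; right=> a va; have := n5 a (Vn a va); rewrite va.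
Qed.

(** * Correctness of one round of cycle elimination *)

Section Rotation.
Variables (n m : nat) (like : nat -> nat -> bool) (f : nat -> nat).

Definition tabulated (s : memory) :=
  s 0 0 0 = n /\ forall i a, i < n -> a < n -> s 10 i a = worth m like f i a.

Lemma enviousP (U : pred nat) s x y : tabulated s -> x < n -> y < n ->
  (s 13 y 0 != 0) = U y -> s 20 0 0 = x -> s 21 0 0 = y ->
  eval s eEnvious = U y && envies m like f y x :> nat.
Proof.
move=> [_ T] xn yn Uy sx sy; rewrite eval_and /= sx sy !T // Uy.
by rewrite subn_eq0 -ltnNge.
Qed.

Lemma run_alive s : tabulated s ->
  forall x, x < n -> (run alive_block s 13 x 0 != 0) = alive n m like f n x.
Proof.
move=> [sn sT]; rewrite /alive_block run_seq.
set s1 := run (tabulate _ _ _ _) s.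
have sn1 : s1 0 0 0 = n by rewrite /s1 run_frame.
set body := BSeq (BFor 20 0 _) _.
pose P r (s' : memory) := forall x, x < n -> (s' 13 x 0 != 0) = alive n m like f r x.
rewrite -{3}sn1; apply: (@run_for P 26 0 body s1) => //.
  move=> x xn; rewrite update_array //=.
  have [||h _] := @run_tabulate (fun _ => 1) 13 20 0 (Const 1) s => //.
  by rewrite /s1 xn h // sn.
move=> r s' rn _ fr h x xn; rewrite update_array //.
have fr1 a p q : a \notin [:: 26; 13; 14; 20; 21] -> s' a p q = s a p q.
  rewrite !inE !negb_or => /and5P[a1 a2 a3 a4 a5].
  rewrite fr //=; last by rewrite !negb_or a2 a3 a4 a5.
  by rewrite /s1 run_frame //= negb_or a2 a4.
rewrite /body run_seq.
set s2 := run (BFor _ _ _) s'.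
have s2E : s2 = run (BFor 20 0 (summation 14 (var 20) (Const 0) 21 0 eEnvious)) s' by [].
have fr2 a p q : a \notin [:: 14; 20; 21] -> s2 a p q = s' a p q.
  rewrite !inE !negb_or => /and3P[a1 a2 a3].
  by rewrite s2E run_frame //= !negb_or a1 a2 a3.
have [//|//|//|||h2 _] := @run_sums
  (fun x y => alive n m like f r y && envies m like f y x) id (fun _ => 0) 14 20 0 21 0
  (var 20) (Const 0) eEnvious s'.
- by move=> s3 i h3.
- move=> s3 i k h3 xi yk; rewrite fr1 // sn => ib kb.
  apply: (@enviousP (alive n m like f r)) => //; last by rewrite h3 // h.
  by split=> [|i' a i'n an]; rewrite h3 // fr1 // sT.
rewrite -s2E fr1 // sn in h2.
have [|s3 k h3 xk kb _|h4 _] :=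
  @run_tabulate (s2 14 ^~ 0) 13 20 0 (Read 14 (var 20) (Const 0)) s2 => //.
  by rewrite /= xk h3.
rewrite h4; last by rewrite fr2 // fr1 // sn.
rewrite h2 // aliveS xn.
exact: (sum_bool_neq0 (fun y => alive n m like f r y && envies m like f y x)).
Qed.

Lemma run_envier (U : pred nat) s : tabulated s ->
  (forall x, x < n -> (s 13 x 0 != 0) = U x) ->
  let s1 := run envier_block s in
  (forall x, x < n -> has (fun y => U y && envies m like f y x) (iota 0 n) ->
     [/\ s1 15 x 0 < n, U (s1 15 x 0) & envies m like f (s1 15 x 0) x]) /\
  s1 15 n 0 = n.
Proof.
move=> [sn sT] sU; rewrite /envier_block run_seq run_write.
set body := BSeq (BWrite 15 (var 20) (Const 0) (var 0)) _.
set s2 := run (BFor 20 0 body) s.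
have s2n : s2 0 0 0 = n by rewrite /s2 run_frame.
rewrite [eval s2 (var 0)]s2n update_eq; split=> // x xn hx.
rewrite update_cell; last by rewrite xpair_eqE andbT neq_ltn xn.
move: x xn hx; rewrite -{1}sn.
pose P i (s' : memory) := forall x, x < i ->
  has (fun y => U y && envies m like f y x) (iota 0 n) ->
     [/\ s' 15 x 0 < n, U (s' 15 x 0) & envies m like f (s' 15 x 0) x].
apply: (@run_for P 20 0 body s) => //.
move=> i s' ib xi fr h x xi' hx; rewrite !update_array //.
rewrite sn in ib.
rewrite /body run_seq run_write.
have s'n : s' 0 0 0 = n by rewrite fr.
rewrite [eval s' (var 20)]xi [eval s' (var 0)]s'n [eval s' (Const 0)]/=.
set s3 := update s' _ _ _ _.
have fr3 a p q : a \notin [:: 15; 20; 21] -> s3 a p q = s a p q.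
  rewrite !inE !negb_or => /and3P[a1 a2 a3].
  by rewrite /s3 update_array // fr //= !negb_or a1 a3.
have [||f1 f2] := @run_search (fun y => U y && envies m like f y i) 15 (var 20) (Const 0)
  21 0 eEnvious i 0 s3 => //.
  move=> s4 k h4 zk; rewrite fr3 // sn => kn.
  have xi4 : s4 20 0 0 = i by rewrite h4 // /s3 update_array.
  split=> //; rewrite (@enviousP U s4 i k) //.
  - by rewrite eqb0 negbK.
  - by split=> [|i' a i'n an]; rewrite h4 // fr3 // sT.
  - by rewrite h4 // fr3 // sU.
rewrite fr3 // sn in f1.
have [xE|ne] := eqVneq x i.
  by move: f1; rewrite -xE hx => /and3P[].
rewrite f2; last by rewrite xpair_eqE (negPf ne).
rewrite /s3 update_cell; last by rewrite xpair_eqE (negPf ne).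
by apply: h => //; lia.
Qed.

Lemma run_walk (U : pred nat) p s : s 0 0 0 = n ->
  (forall x, x < n -> (s 13 x 0 != 0) = U x) ->
  (forall x, U x -> x < n) ->
  (forall x, s 15 x 0 = p x) ->
  exists2 y, if has U (iota 0 n) then U y else y == n & run walk_block s 16 0 0 = iter n p y.
Proof.
move=> sn sU Un sp; rewrite /walk_block !run_seq run_write.
set s1 := update s _ _ _ _.
set s2 := run _ s1.
have s1n : s1 0 0 0 = n by [].
have [||h _] := @run_search U 16 (Const 0) (Const 0) 21 0 (Read 13 (var 21) (Const 0)) 0 0 s1 => //.
  by move=> s' k fr zk; rewrite s1n => kn; rewrite /= zk fr // sU.
rewrite -/s2 s1n in h.
exists (s2 16 0 0).
  by move: h; case: ifP => _ => [/andP[]//|/eqP ->]; rewrite /s1 update_eq /= sn.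
set body := BWrite _ _ _ _.
have s2n : s2 0 0 0 = n by rewrite /s2 run_frame.
rewrite -s2n.
pose P i (s' : memory) := s' 16 0 0 = iter i p (s2 16 0 0).
apply: (@run_for P 26 0 body s2) => // i s' ib zi fr h'.
rewrite /P iterS -h' -sp update_array // /body run_write update_eq /= fr //.
by rewrite /s2 run_frame.
Qed.

Lemma run_relabel p y s : s 0 0 0 = n -> s 1 0 0 = m -> s 16 0 0 = y ->
  (forall x, s 15 x 0 = p x) ->
  (forall j, j < m -> owner s j = f j /\ f j <= n) ->
  forall j, j < m -> owner (run relabel_block s) j =
    if f j \in traject p y n then p (f j) else f j.
Proof.
move=> sn sm sy sp sf j jm; rewrite /relabel_block !run_seq run_write.
set s0 := run (tabulate _ _ _ _) s.
have s0E : s0 = run (tabulate 17 20 0 (var 20)) s by [].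
have s0n : s0 0 0 0 = n by rewrite s0E run_frame.
rewrite [eval s0 (var 0)]s0n; set s1 := update s0 _ _ _ _.
have [|s' k _ h|g1 _] := @run_tabulate id 17 20 0 (var 20) s => //.
rewrite -s0E sn in g1.
have s1id x : x <= n -> s1 17 x 0 = x.
  rewrite leq_eqVlt => /orP[/eqP ->|xn]; first by rewrite /s1 update_eq.
  by rewrite /s1 update_cell ?g1 // xpair_eqE andbT neq_ltn xn.
set body := BSeq _ _.
have s1n : s1 0 0 0 = n by [].
set s2 := run (BFor _ _ _) s1.
have s2E : s2 = run (BFor 26 0 body) s1 by [].
have fr1 a q r : a \notin [:: 17; 20] -> s1 a q r = s a q r.
  rewrite !inE !negb_or => /andP[a1 a2].
  by rewrite /s1 update_array // s0E run_frame //= negb_or a1 a2.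
have h2 : s2 16 0 0 = iter n p y /\
   forall x, x <= n -> s2 17 x 0 = if x \in traject p y n then p x else x.
  rewrite s2E -{1 3}s1n.
  pose P i (s' : memory) := s' 16 0 0 = iter i p y /\
    forall x, x <= n -> s' 17 x 0 = if x \in traject p y i then p x else x.
  apply: (@run_for P 26 0 body s1) => //.
    split=> [|x xn]; last by rewrite update_array // s1id.
    by rewrite update_array // fr1.
  move=> i s' ib zi fr [h16 h17].
  have s'p x : s' 15 x 0 = p x by rewrite fr // fr1.
  split=> [|x xn].
    by change (s' 15 (s' 16 0 0) 0 = iter i.+1 p y); rewrite s'p h16.
  change (update s' 17 (s' 16 0 0) 0 (s' 15 (s' 16 0 0) 0) 17 x 0 =
    if x \in traject p y i.+1 then p x else x).
  rewrite s'p h16 trajectSr mem_rcons inE.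
  have [->|xi] := eqVneq x (iter i p y); first by rewrite update_eq.
  by rewrite update_cell ?xpair_eqE ?(negPf xi) // h17.
have s2m : s2 1 0 0 = m by rewrite s2E run_frame // fr1.
have [|s' k fr zk km s4|h4 _] := @run_tabulate
  (fun k => if f k \in traject p y n then p (f k) else f k) 4 20 1
  (Read 17 (Read 4 (var 20) (Const 0)) (Const 0)) s2 => //.
  rewrite s2m in km; have [fk fkn] := sf k km.
  rewrite /= zk s4 s2E run_frame // fr1 // -[s 4 k 0]/(owner s k) fk.
  by rewrite fr // h2.2.
by rewrite /owner h4 // s2m.
Qed.

End Rotation.

(** If some agent is left by the exclusion, walking backwards along chosen enviers ends on a cycle,
    and the shift along it is a rotation. If none is left, [alive_sub] shows that envy is acyclic,
    and the walk rests at the dummy agent. *)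
Lemma run_rotation s like :
  let n := s 0 0 0 in let m := s 1 0 0 in
  let f := owner s in let g := owner (run rotation_block s) in
  (forall i k, likes s i k = like i k) -> (forall j, j < m -> f j <= n) ->
  (forall j, j < m -> g j <= n) /\
  ((acyclic n m like f /\ forall j, j < m -> g j = f j) \/
   rotation n m like f g).
Proof.
move=> n m f g likeE fn.
pose s1 := run worth_block s.
have t1 : tabulated n m like f s1.
  by split=> [|i a ni na]; [rewrite /s1 run_frame|apply: run_worth].
pose U := alive n m like f n.
pose s2 := run alive_block s1.
have s2U x : x < n -> (s2 13 x 0 != 0) = U x by apply: run_alive.
have t2 : tabulated n m like f s2.
  have [t11 t12] := t1.
  by split=> [|i a ni na]; rewrite /s2 run_frame //; apply: t12.
pose s3 := run envier_block s2.
have [pU pn] := run_envier t2 s2U.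
rewrite -/s3 in pU pn.
pose p x := s3 15 x 0.
have Un x : U x -> x < n by apply: alive_lt.
have Up x : U x -> U (p x) /\ envies m like f (p x) x.
  move=> Ux; have [xn [y Uy e]] := alive_closed Ux.
  have [|_ h1 h2] := pU x xn; last by [].
  by apply/hasP; exists y; rewrite ?mem_iota ?Un //; apply/andP.
have [||||y hy zE] := @run_walk n U p s3 => //.
- by rewrite /s3 /s2 /s1 !run_frame.
- by move=> x xn; rewrite /s3 run_frame // s2U.
set s4 := run walk_block s3 in zE.
have gE j : j < m -> g j = if f j \in traject p (iter n p y) n then p (f j) else f j.
  have -> : g = owner (run relabel_block s4) by [].
  have fr4 a q r : a \in [:: 0; 1; 4] -> s4 a q r = s a q r.
    by rewrite !inE => /or3P[] /eqP ->; rewrite /s4 /s3 /s2 /s1 !run_frame.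
  apply: run_relabel; rewrite ?(fr4 0) ?(fr4 1) //.
  - by move=> x; rewrite /s4 run_frame.
  - by move=> k km; split; [rewrite /owner fr4|apply: fn].
have [hU|hU] := boolP (has U (iota 0 n)); last first.
  move: hy; rewrite (negPf hU) => /eqP yn.
  have it k : iter k p n = n by elim: k => //= k ->.
  have gf j : j < m -> g j = f j.
    move=> jm; rewrite gE // yn it; case: ifP => // /trajectP[i _ ->].
    by rewrite it.
  split=> [j jm|]; first by rewrite gf ?fn.
  left; split=> // W cW x; apply: contra hU => Wx; apply/hasP; exists x.
    by rewrite mem_iota; have [] := cW x Wx.
  exact: alive_sub cW Wx.
rewrite hU in hy.
have [CU zC Cp ri] := @shift_facts n p U y Un (fun x Ux => (Up x Ux).1) hy.
set C := traject _ _ _ in gE CU zC Cp ri.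
have pCn x : x \in C -> p x < n by move=> xC; apply: Un; apply: CU; apply: Cp.
split.
  move=> j jm; rewrite gE //; case: ifP => [fC|_]; last exact: fn.
  by apply: ltnW; apply: pCn.
right; exists (fun x => x \in C), (fun x => if x \in C then p x else x); split=> //.
- by exists (iter n p y).
- move=> x Cx; have Ux := CU x Cx; split; first exact: Un.
  case/trajectP: Cx (Cx) => i _ xE Cx.
  by exists (p x); [apply: Cp|have [] := Up x Ux].
- split=> // x; case: ifP => // xC; rewrite pCn //; apply/esym/Un/CU/xC.
- move=> x xn; case xC: (x \in C) => //; by have [] := Up x (CU x xC).
Qed.

Definition untangle_block := BFor 24 0 (BFor 25 1 rotation_block).

Lemma run_untangle s like f j c :
  let n := s 0 0 0 in let m := s 1 0 0 in
  let f1 := place f j c in let g := owner (run untangle_block s) in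
  (forall i k, likes s i k = like i k) -> (forall k, owner s k = f1 k) ->
  (forall k, k < m -> f k <= n) -> j < m -> f j = n -> c < n -> acyclic n m like f ->
  envy_bounded n m like f1 ->
  (forall k, k < m -> g k <= n) /\ exists2 t, n * m <= t & untangled n m like f1 j t g.
Proof.
move=> n m f1 g likeE sf fn jm fj cn af ef.
pose I t (s' : memory) := [/\ forall k, k < m -> owner s' k <= n
  & untangled n m like f1 j t (owner s')].
have I0 : I 0 s.
  split.
    by move=> k km; rewrite sf /f1 /place; case: ifP => _; [apply: ltnW|apply: fn].
  have [e h1 h2 h3 h4] := @untangled0 n m like f1 j ef.
  have sf' k : k < m -> owner s k = f1 k by move=> _; apply: sf.
  split; [exact: envy_bounded_ext sf' ef|by move=> k _; rewrite sf| |by left|by right].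
  by move=> k k' _ _ _ _; rewrite !sf.
have IS t s' : s' 0 0 0 = n -> s' 1 0 0 = m -> (forall i k, likes s' i k = like i k) ->
    I t s' -> I t.+1 (run rotation_block s').
  move=> sn sm sl [gn un]; have := @run_rotation s' like; rewrite sn sm => /(_ sl gn) [gn' rot].
  by split=> //; apply: (untangledS jm _ cn af un); rewrite ?fj.
suff [h1 h2] : I (n * m) (run untangle_block s) by split=> //; exists (n * m).
(* The two nested loops serve only to count [n * m] rounds: in round [k] of outer round [i], the
   count is [i * m + k]. *)
pose P i (s' : memory) := I (i * m) s'.
apply: (@run_for P 24 0 (BFor 25 1 rotation_block) s) => // i s' ib _ fr Pi.
have s'm : s' 1 0 0 = m by rewrite fr.
pose Q k (s' : memory) := I (i * m + k) s'.
suff : Q m (run (BFor 25 1 rotation_block) s') by rewrite /P mulSn addnC.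
rewrite -{1}s'm; apply: (@run_for Q 25 1 rotation_block s') => //.
  by rewrite /Q addn0.
move=> k s2 kb _ fr2 Qk; rewrite /Q addnS.
apply: IS; rewrite ?fr2 ?fr // => a b; by rewrite -likeE /likes fr2 ?fr.
Qed.

Lemma sum_le1_uniq (b : pred nat) N x y : \sum_(k < N) b k <= 1 ->
  x < N -> y < N -> b x -> b y -> x = y.
Proof.
move=> h xN yN bx by_; apply/eqP; move: h; apply: contraLR => xy.
rewrite (bigD1 (Ordinal xN)) //= (bigD1 (Ordinal yN)) /=; first by rewrite bx by_.
by rewrite eq_sym; apply: contra xy => /eqP [->].
Qed.

(** * Listing the items so that only consecutive ones are in conflict *)

Section Order.
Variables (m : nat) (adj : nat -> nat -> bool).
Hypothesis adj_lt : forall x y, adj x y -> y < m.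
Hypothesis adj_sym : forall x y, adj x y = adj y x.
Hypothesis adj_irr : forall x, ~~ adj x x.
Hypothesis degree_le2 : forall x y1 y2 y3, adj x y1 -> adj x y2 -> adj x y3 ->
  [\/ y1 = y2, y1 = y3 | y2 = y3].
Hypothesis closed_end : forall W : pred nat, (forall x, W x -> x < m) ->
  (forall x y, W x -> adj x y -> W y) -> forall x, W x ->
  exists2 y, W y & \sum_(k < m) adj y k <= 1.

Definition seen (o : nat -> nat) k x := has (fun i => o i == x) (iota 0 k).

Lemma seenP o k x : reflect (exists2 i, i < k & o i = x) (seen o k x).
Proof.
apply: (iffP hasP) => [[i]|[i ik <-]]; last by exists i; rewrite ?mem_iota.
by rewrite mem_iota => ik /eqP; exists i.
Qed.

(* The first k cells of o start an order in which only consecutive items are  *)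
(* in conflict; prev is the last of them.                                     *)
Definition ordered o k prev :=
  [/\ forall i, i < k -> o i < m,
      {in gtn k &, injective o},
      forall i j, i < k -> j < k -> adj (o i) (o j) -> i = j.+1 \/ j = i.+1,
      forall i y, i < k -> adj (o i) y -> ~~ seen o k y -> i.+1 = k
    & (forall y z, adj prev y -> adj prev z -> ~~ seen o k y -> ~~ seen o k z -> y = z) /\
      if k is k'.+1 then prev = o k' else prev = m].

Lemma seen_ext o k nx o' x : (forall i, i < k -> o' i = o i) -> o' k = nx ->
  seen o' k.+1 x = seen o k x || (nx == x).
Proof.
move=> oE ok; rewrite /seen -addn1 iotaD has_cat /= orbF add0n ok; congr (_ || _).
by apply: eq_in_has => i; rewrite mem_iota => ik; rewrite oE.
Qed.

Lemma unseen_end o k prev : k < m -> ordered o k prev ->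
  (forall y, y < m -> ~~ seen o k y -> ~~ adj prev y) ->
  exists x, [/\ x < m, ~~ seen o k x & \sum_(i < m) adj x i <= 1].
Proof.
move=> km [om oi oe on [_ op]] hp.
have [x xm xo] : exists2 x, x < m & ~~ seen o k x.
  have [/hasP[x]|/hasPn h] := boolP (has (fun x => ~~ seen o k x) (iota 0 m)).
    by rewrite mem_iota => xm ox; exists x.
  have : size (iota 0 m) <= size (map o (iota 0 k)).
    apply: uniq_leq_size; first exact: iota_uniq.
    move=> x xm; have := h x xm; rewrite negbK => /seenP[i ik <-].
    by apply: map_f; rewrite mem_iota.
  by rewrite size_map !size_iota; lia.
have [|||y] := @closed_end (fun x => (x < m) && ~~ seen o k x) _ _ x.
- by move=> y /andP[].
- move=> y z /andP[ym yo] yz; rewrite (adj_lt yz) /=; apply/negP => /seenP[i ik oz].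
  have zy : adj (o i) y by rewrite oz adj_sym.
  have ki := on i y ik zy yo; have /negP[] := hp y ym yo.
  by move: op; rewrite -ki => ->.
- by rewrite xm.
- by case/andP => ym yo dy; exists y.
Qed.

(** The new item has at most one unseen neighbour: either it follows [prev], which uses up one of
    its at most two neighbours, or it is the end of a path. *)
Lemma orderedS o k prev o' nx : k < m -> ordered o k prev ->
  nx < m -> ~~ seen o k nx ->
  adj prev nx \/ (forall y, y < m -> ~~ seen o k y -> ~~ adj prev y) /\
                 \sum_(i < m) adj nx i <= 1 ->
  (forall i, i < k -> o' i = o i) -> o' k = nx -> ordered o' k.+1 nx.
Proof.
move=> km [om oi oe on [ou op]] nm nu hx oE ok.
have sE x := @seen_ext o k nx o' x oE ok.
have lt i : i < k.+1 -> i = k \/ i < k by lia.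
have last_prev i : i.+1 = k -> prev = o i by move=> ik; move: op; rewrite -ik.
split.
- by move=> i /lt[->|ik]; rewrite ?ok // oE ?om.
- have new i : i < k -> o i <> nx by move=> ik e; case/seenP: nu; exists i.
  move=> i j /lt[->|ik] /lt[->|jk] //.
  + by rewrite ok oE // => /esym /(new _ jk).
  + by rewrite ok oE // => /(new _ ik).
  + by rewrite !oE // => /oi; apply.
- move=> i j /lt[->|ik] /lt[->|jk].
  + by move=> h; move: (adj_irr (o' k)); rewrite h.
  + by rewrite ok oE // adj_sym => /(on j nx jk) /(_ nu) ->; left.
  + by rewrite ok oE // => /(on i nx ik) /(_ nu) ->; right.
  + by rewrite !oE //; apply: oe.
- move=> i y /lt[-> //|ik].
  rewrite oE // sE negb_or => iy /andP[yu ynx].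
  have pi := last_prev i (on i y ik iy yu).
  case: hx => [an|[hn _]].
    by case/eqP: ynx; apply: ou; rewrite // pi.
  by have /negP[] := hn y (adj_lt iy) yu; rewrite pi.
- split; last by rewrite ok.
  move=> y z ay az; rewrite !sE !negb_or => /andP[yu _] /andP[zu _].
  case: hx => [an|[_ d]].
    have ps : seen o k prev.
      case: (k) op => [pm|k' ->]; last by apply/seenP; exists k'.
      by move: an; rewrite adj_sym pm => /adj_lt; rewrite ltnn.
    rewrite adj_sym in an.
    case: (degree_le2 ay az an) => // e.
      by rewrite e ps in yu.
    by rewrite e ps in zu.
  by apply: (sum_le1_uniq (b := adj nx) d) => //; apply: adj_lt; eassumption.
Qed.

(** The search for a neighbour comes last and so prevails; an end of a path is taken only when the
    current path is exhausted. The sentinel [m], adjacent to nothing, stands for the missing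
    previous item at the start. *)
Lemma run_order s : s 1 0 0 = m -> (forall x y, (s 3 x y != 0) = adj x y) ->
  (forall x, s 7 x 0 = 0) ->
  let o k := run order_block s 6 k 0 in
  [/\ forall i, i < m -> o i < m,
      {in gtn m &, injective o}
    & forall i j, i < m -> j < m -> adj (o i) (o j) -> i = j.+1 \/ j = i.+1].
Proof.
move=> sm sadj s7; rewrite /order_block !run_seq run_write.
set s1 := run (BFor 20 1 _) s.
have s1m : s1 1 0 0 = m by rewrite /s1 run_frame.
have s15 x : x < m -> s1 5 x 0 = \sum_(k < m) adj x k.
  have [//|//|//|||h2 _] := @run_sums (fun x y => adj x y) id (fun _ => 0) 5 20 1 21 1
    (var 20) (Const 0) (eNot (eNot (Read 3 (var 20) (var 21)))) s.
  - by move=> s3 i h3.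
  - move=> s3 i k h3 xi yk _ _; rewrite !eval_not /= xi yk h3 // -sadj.
    by case: (s 3 i k).
  - by move=> xm; rewrite /s1 h2 // sm.
rewrite [eval s1 (var 1)]s1m; set s2 := update s1 _ _ _ _.
set body := BSeq (BWrite 9 _ _ _) _.
have s2m : s2 1 0 0 = m by [].
pose P k (s' : memory) := [/\ ordered (fun i => s' 6 i 0) k (s' 8 0 0)
  & forall x, (s' 7 x 0 != 0) = seen (fun i => s' 6 i 0) k x].
suff [[h1 h2 h3 _ _] _] : P m (run (BFor 23 1 body) s2) by [].
rewrite -{1}s2m; apply: (@run_for P 23 1 body s2) => //.
  split; last by move=> x; rewrite update_array // -[s2 7 x 0]/(s1 7 x 0) /s1 run_frame // s7.
  split=> //; rewrite !update_array // /s2 update_eq; split=> // y z.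
  by rewrite adj_sym => /adj_lt; rewrite ltnn.
move=> k s' km ki fr [ord' sn].
rewrite s2m in km.
set o := (fun i => s' 6 i 0) in ord' sn.
set prev := s' 8 0 0 in ord'.
rewrite /body !run_seq [run (BWrite 9 _ _ _) _]run_write.
have s'm : s' 1 0 0 = m by rewrite fr.
rewrite [eval s' (var 1)]s'm [eval s' (Const 0)]/=; set s3 := update s' 9 _ _ _.
set s4 := run (search _ _ _ _ _ _) s3.
set s5 := run (search _ _ _ _ _ _) s4.
have s'5 x : x < m -> s' 5 x 0 = \sum_(i < m) adj x i.
  by move=> xm; rewrite fr // -s15.
have s'3 x y : (s' 3 x y != 0) = adj x y.
  by rewrite fr // -[s2 3 x y]/(s1 3 x y) /s1 run_frame // sadj.
have fr3 a p q : a != 9 -> s3 a p q = s' a p q by move=> h; rewrite /s3 update_array.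
have fr4 a p q : a != 9 -> a != 21 -> s4 a p q = s' a p q.
  by move=> h1 h2; rewrite /s4 run_frame ?fr3 //= negb_or h1 h2.
have fr5 a p q : a != 9 -> a != 21 -> s5 a p q = s' a p q.
  by move=> h1 h2; rewrite /s5 run_frame ?fr4 //= negb_or h1 h2.
have [||h4 _] := @run_search (fun x => ~~ seen o k x && (\sum_(i < m) adj x i <= 1))
   9 (Const 0) (Const 0) 21 1 (eAnd (eNot (Read 7 (var 21) (Const 0)))
     (eNot (Sub (Read 5 (var 21) (Const 0)) (Const 1)))) 0 0 s3 => //.
  move=> s6 x h6 zx; rewrite fr3 // s'm => xm; split=> //.
  rewrite eval_and !eval_not /= zx !h6 // !fr3 // s'5 // -sn subn_eq0 !eqb0 !negbK.
  by case: (_ <= 1); rewrite ?andbT ?andbF.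
have [||h5 _] := @run_search (fun x => ~~ seen o k x && adj prev x)
   9 (Const 0) (Const 0) 21 1 (eAnd (eNot (Read 7 (var 21) (Const 0)))
     (Read 3 (var 8) (var 21))) 0 0 s4 => //.
  move=> s6 x h6 zx; rewrite fr4 // s'm => xm; split=> //.
  rewrite eval_and !eval_not /= zx !h6 // !fr4 // s'3 -sn !eqb0 !negbK //.
rewrite -/s4 fr3 // s'm in h4; rewrite -/s5 fr4 // s'm in h5.
pose nx := s5 9 0 0.
have [nm nu hx] : [/\ nx < m, ~~ seen o k nx & adj prev nx \/
     (forall y, y < m -> ~~ seen o k y -> ~~ adj prev y) /\ \sum_(i < m) adj nx i <= 1].
  move: h5; rewrite -/nx; case: ifPn => [_ /andP[nm /andP[nu an]]|/hasPn hn /eqP nxE].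
    by split=> //; left.
  have hn' y : y < m -> ~~ seen o k y -> ~~ adj prev y.
    by move=> ym yu; have := hn y; rewrite mem_iota ym yu; apply.
  have [x [xm xu xd]] := unseen_end km ord' hn'.
  move: h4; rewrite -nxE ifT; last by apply/hasP; exists x; rewrite ?mem_iota ?xu.
  by case/and3P => nm nu nd; split=> //; right.
rewrite !run_write.
have e6 : eval s5 (var 23) = k by rewrite /= fr5.
rewrite e6 [eval s5 (Const 0)]/= [eval s5 (var 9)]/= -/nx.
set s6 := update s5 6 k 0 nx.
have -> : eval s6 (var 9) = nx by [].
rewrite [eval s6 _]/= [eval s6 _]/=; set s7' := update s6 7 nx 0 1.
have -> : eval s7' (var 9) = nx by [].
rewrite [eval s7' _]/=.
have o'E i : i < k -> s6 6 i 0 = o i.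
  by move=> ik; rewrite /s6 update_cell ?fr5 // xpair_eqE andbT neq_ltn ik.
have o'k : s6 6 k 0 = nx by rewrite /s6 update_eq.
split.
  exact: (@orderedS o k prev (fun i => s6 6 i 0) nx).
move=> x; change ((update s6 7 nx 0 1 7 x 0 != 0) = seen (fun i => s6 6 i 0) k.+1 x).
rewrite (seen_ext x o'E o'k).
have [<-|xnx] := eqVneq nx x; first by rewrite update_eq orbT.
rewrite update_cell ?orbF; last by rewrite xpair_eqE eq_sym (negPf xnx).
by rewrite -sn -(fr5 7).
Qed.
End Order.

(** * The main loop *)

Lemma surj_lt m (o : nat -> nat) : (forall i, i < m -> o i < m) -> {in gtn m &, injective o} ->
  forall x, x < m -> exists2 i, i < m & o i = x.
Proof.
move=> om oi x xm.
pose r i := if i < m then o i else i.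
have rm i : (r i < m) = (i < m) by rewrite /r; case: ifP => // /om.
have ri : {in gtn m &, injective r}.
  by move=> i j im jm; rewrite /r ifT // ifT //; apply: oi.
by have [i im <-] := surj_of_inj ri rm xm; exists i; rewrite // /r im.
Qed.

Lemma run_main n m adj s : s 0 0 0 = n -> s 1 0 0 = m -> 2 < n ->
  (forall x y, (s 3 x y != 0) = adj x y) -> (forall x, s 7 x 0 = 0) ->
  (forall x y, adj x y -> y < m) -> (forall x y, adj x y = adj y x) ->
  (forall x, ~~ adj x x) ->
  (forall x y1 y2 y3, adj x y1 -> adj x y2 -> adj x y3 -> [\/ y1 = y2, y1 = y3 | y2 = y3]) ->
  (forall W : pred nat, (forall x, W x -> x < m) ->
    (forall x y, W x -> adj x y -> W y) -> forall x, W x ->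
    exists2 y, W y & \sum_(k < m) adj y k <= 1) ->
  let g := owner (run main_block s) in
  [/\ forall j, j < m -> g j < n, envy_bounded n m (likes s) g
    & forall x y, adj x y -> g x <> g y].
Proof.
move=> sn sm n3 s3 s7 a1 a2 a3 a4 a5; rewrite /main_block !run_seq.
set like := likes s.
have [] := run_order a1 a2 a3 a4 a5 sm s3 s7.
set s1 := run order_block s; pose o k := s1 6 k 0.
move=> om oi oe.
set s2 := run (tabulate _ _ _ _) s1.
set body := BSeq choice_block _.
have s1n : s1 0 0 0 = n by rewrite /s1 run_frame.
have s1m : s1 1 0 0 = m by rewrite /s1 run_frame.
have s2n : s2 0 0 0 = n by rewrite /s2 run_frame.
have s2m : s2 1 0 0 = m by rewrite /s2 run_frame.
have s2o k : s2 6 k 0 = o k by rewrite /s2 run_frame.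
have s2l i j : likes s2 i j = like i j.
  by rewrite /like /likes /s2 run_frame // /s1 run_frame.
have s2f j : j < m -> owner s2 j = n.
  have [//|s' k h _ _ _|h _] := @run_tabulate (fun _ => n) 4 20 1 (var 0) s1.
    by rewrite /= h.
  by move=> jm; rewrite /owner /s2 h // s1m.
pose P k (s' : memory) := [/\ forall j, j < m -> owner s' j <= n,
  forall i, i < m -> (owner s' (o i) < n) = (i < k),
  envy_bounded n m like (owner s') /\ acyclic n m like (owner s'),
  forall i, i.+1 < k -> owner s' (o i) <> owner s' (o i.+1)
  & k < m -> good n m like (owner s') (owner s' (s' 8 0 0)) (like ^~ (o k)) /\
             (0 < k -> s' 8 0 0 = o k.-1)].
suff : P m (run (BFor 23 1 body) s2).
  case=> h1 h2 [h3 _] h4 _; split=> //.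
    by move=> j jm; have [i im <-] := surj_lt om oi jm; rewrite h2.
  move=> x y xy; have ym := a1 _ _ xy; have xm : x < m by apply: (a1 y); rewrite a2.
  have [i im xi] := surj_lt om oi xm; have [j jm yj] := surj_lt om oi ym.
  move: xy; rewrite -xi -yj => /(oe _ _ im jm) [e|e].
    by apply/nesym; rewrite e; apply: h4; rewrite -e.
  by rewrite e; apply: h4; rewrite -e.
have w0 f i a : (forall j, j < m -> f j = n) -> a < n -> worth m like f i a = 0.
  move=> fn an; rewrite /worth big1 // => j _; rewrite fn //.
  by rewrite [n == a]gtn_eqF // andbF.
rewrite -{1}s2m; apply: (@run_for P 23 1 body s2) => //.
  have fE j : j < m -> owner (update s2 23 0 0 0) j = n.
    by move=> jm; rewrite /owner update_array // -/(owner s2 j) s2f.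
  have ac : acyclic n m like (owner (update s2 23 0 0 0)).
    move=> W cW x; apply/negP => /cW[xn [y /cW[yn _]]].
    by rewrite /envies !w0.
  split.
  - by move=> j jm; rewrite fE.
  - by move=> i im; rewrite fE ?ltnn // om.
  - by split=> // i a ni na; rewrite !w0.
  - by [].
  (* Cell 8 still holds a leftover of the ordering, but while nothing is allocated everybody is
     content, so any last owner will do. *)
  - move=> m0; split=> //; apply: good_of_content => // _ ln a an.
    by rewrite !w0.
move=> k s' km ki fr [f1 f2 [f3 f4] f5 f6].
rewrite s2m in km.
have [gd pk] := f6 km.
set f := owner s' in f1 f2 f3 f4 f5 gd.
have s'n : s' 0 0 0 = n by rewrite fr.
have s'm : s' 1 0 0 = m by rewrite fr.
have s'o i : s' 6 i 0 = o i by rewrite fr.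
have s'l i j : likes s' i j = like i j by rewrite -s2l /likes fr.
have := @run_choice s' like; cbv zeta.
rewrite s'n s'm ki !s'o => /(_ s'l (om k km) gd) [].
set s3' := run choice_block s'; set c := s3' 12 0 0 => vc hc.
rewrite /body !run_seq -/s3' -/untangle_block run_write.
have fr3 a p q : ~~ writes a choice_block -> s3' a p q = s' a p q.
  by move=> h; rewrite /s3' run_frame.
rewrite [run (BWrite 4 _ _ _) _]run_write.
have -> : eval s3' eItem = o k by rewrite /= !fr3 // ki s'o.
rewrite [eval s3' (Const 0)]/= [eval s3' (var 12)]/= -/c.
set s4 := update s3' 4 (o k) 0 c.
have s4f j : owner s4 j = place f (o k) c j.
  rewrite /owner /s4 /place; case: eqVneq => [->|ne]; first by rewrite update_eq.
  by rewrite update_cell ?fr3 // xpair_eqE (negPf ne).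
have fr4 a p q : a != 4 -> ~~ writes a choice_block -> s4 a p q = s' a p q.
  by move=> h1 h2; rewrite /s4 update_array ?fr3.
have s4l i j : likes s4 i j = like i j by rewrite -s'l /likes fr4.
have fok : f (o k) = n.
  by apply/eqP; rewrite eqn_leq f1 ?om // leqNgt f2 // ltnn.
have cn : c < n by case/and3P: vc.
have ep : envy_bounded n m like (place f (o k) c).
  by apply: (@envy_bounded_place n m like f _ (o k) c _ _ f3 vc); rewrite ?om ?fok.
have := @run_untangle s4 like f (o k) c; cbv zeta.
rewrite !fr4 // s'n s'm => /(_ s4l s4f f1 (om k km) fok cn f4 ep) [].
set s5 := run untangle_block s4 => gn [t nt [eg gnn gi gE ga]].
have ag : acyclic n m like (owner s5).
  by case: ga => // h; apply: acyclic_of_max; apply: leq_trans h.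
have s5o i : s5 6 i 0 = o i by rewrite /s5 run_frame // fr4.
have -> : eval s5 eItem = o k by rewrite /= /s5 !run_frame // !fr4 // ki s'o.
have fl i : i < m -> (owner s5 (o i) < n) = (i < k.+1).
  move=> im; rewrite gnn ?om // /place ltnS [i <= k]leq_eqVlt.
  have [e|ne] := eqVneq (o i) (o k).
    by rewrite cn (oi i k) // eqxx.
  by rewrite f2 //; case: eqVneq => // ik; rewrite ik eqxx in ne.
split=> //.
  move=> i; rewrite ltnS => ik.
  have im : i < m by lia.
  have im1 : i.+1 < m by lia.
  have pn i' : i' < k.+1 -> place f (o k) c (o i') < n.
    by move=> i'k; rewrite -gnn ?om ?fl //; lia.
  (* Rotations never merge bundles, so equal owners now were equal right after the placement. For
     the new item this is excluded by [valid]. *)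
  move=> /(gi _ _ (om _ im) (om _ im1) (pn i (ltnW ik)) (pn i.+1 ik)).
  rewrite /place.
  have [e|_] := eqVneq (o i) (o k); first by have := oi i k im km e; lia.
  have [e|ne] := eqVneq (o i.+1) (o k); last first.
    apply: f5; rewrite ltn_neqAle ik andbT; apply: contra ne => /eqP ->; exact: eqxx.
  have ki1 : k = i.+1 by rewrite (oi i.+1 k im1 km e).
  move: vc pk; rewrite ki1 => /and3P[_ cl _] /(_ isT) /= pE.
  by move=> fc; rewrite -fc pE eqxx in cl.
move=> k1m; split=> //.
have := @good_step n m like f (f (s' 8 0 0)) (o k) c (like^~ (o k.+1)) (owner s5).
by apply; rewrite ?om ?fok //; apply: hc; apply: om.
Qed.

(** * Instances *)

Section Paths.
Variables (T : finType) (e : rel T).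
Hypothesis paths : components_are_paths e.

Lemma path_degree_le2 x y1 y2 y3 : e x y1 -> e x y2 -> e x y3 ->
  [\/ y1 = y2, y1 = y3 | y2 = y3].
Proof.
have [s [us sE se]] := paths x.
have xC : x \in component e x by rewrite inE connect0.
have nb y : e x y -> y \in s /\ (index y s = (index x s).+1 \/ (index y s).+1 = index x s).
  move=> xy; have yC : y \in component e x by rewrite inE connect1.
  split; first by rewrite sE.
  by have := se x y xC yC; rewrite xy => /esym /orP[/eqP ->|/eqP ->]; [left|right].
move=> /nb[s1 i1] /nb[s2 i2] /nb[s3 i3].
have inj y z : y \in s -> z \in s -> index y s = index z s -> y = z.
  by move=> ys zs h; rewrite -(nth_index x ys) h nth_index.
have [h|[h|h]] : index y1 s = index y2 s \/ index y1 s = index y3 s \/ index y2 s = index y3 s.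
  by lia.
- by constructor 1; apply: inj.
- by constructor 2; apply: inj.
- by constructor 3; apply: inj.
Qed.

Lemma path_end x : exists2 h, connect e x h & forall y z, e h y -> e h z -> y = z.
Proof.
have [s [us sE se]] := paths x.
have xs : x \in s by rewrite sE inE connect0.
case: s us sE se xs => [//|h s] us sE se _.
have hC : h \in component e x by rewrite -sE mem_head.
have xh : connect e x h by rewrite inE in hC.
exists h => //.
have nb y : e h y -> y \in h :: s /\ index y (h :: s) = 1.
  move=> hy; have yC : y \in component e x by rewrite inE (connect_trans xh) ?connect1.
  split; first by rewrite sE.
  by have := se h y hC yC; rewrite hy [index h _]/= eqxx => /esym /orP[/eqP <-|].
move=> y z /nb[ys iy] /nb[zs iz].
by rewrite -(nth_index h ys) iy -iz nth_index.
Qed.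
End Paths.

Lemma sum_bool_le1 (b : pred nat) N :
  (forall x y, x < N -> y < N -> b x -> b y -> x = y) -> \sum_(k < N) b k <= 1.
Proof.
move=> h; case: (pickP (fun k : 'I_N => b k)) => [k bk|nb]; last first.
  by rewrite big1 // => k _; rewrite nb.
rewrite (bigD1 k) //= bk big1 // => i ik; case bi: (b i) => //.
by case/eqP: ik; apply: val_inj; apply: h (ltn_ord i) (ltn_ord k) bi bk.
Qed.

(** * From the memory of the program back to instances *)

Section Instance.
Variables (R : realFieldType) (I : instance R).
Hypotheses (n3 : 2 < nagents I) (binary : binary_values I)
  (paths : components_are_paths (@conflict R I)).
Let s := binary_input I.
Let n := nagents I.
Let m := nitems I.

Lemma binary_input_likes (i : 'I_n) (j : 'I_m) :
  item_value i j = (likes s i j)%:R%R.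
Proof.
rewrite /likes /s /binary_input !valK eqb0 negbK.
by case: (binary i j) => ->; rewrite ?eqxx // eq_sym oner_eq0.
Qed.

Definition conflicts x y := s 3 x y != 0.

Lemma conflictsP (x y : nat) :
  reflect (exists i j : 'I_m, [/\ x = i :> nat, y = j :> nat & conflict i j]) (conflicts x y).
Proof.
rewrite /conflicts /s /binary_input.
case: insubP => [i _ <-|xm]; last first.
  by constructor=> -[i [j [xi _ _]]]; rewrite xi ltn_ord in xm.
case: insubP => [j _ <-|ym]; last first.
  by constructor=> -[i' [j [_ yj _]]]; rewrite yj ltn_ord in ym.
rewrite eqb0 negbK; apply: (iffP idP) => [ij|[i' [j' [/val_inj -> /val_inj ->]]] //].
by exists i, j.
Qed.

Lemma run_main_binary_input : let g := owner (run main_block s) in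
  [/\ forall j, j < m -> g j < n, envy_bounded n m (likes s) g
    & forall x y, conflicts x y -> g x <> g y].
Proof.
apply: (@run_main n m conflicts s) => //.
- by move=> x y /conflictsP[i [j [_ -> _]]].
- move=> x y; apply/conflictsP/conflictsP => -[i [j [-> -> ij]]]; exists j, i; split=> //.
    by rewrite conflict_sym.
  by rewrite conflict_sym.
- move=> x; apply/conflictsP => -[i [j [-> /val_inj <-]]].
  by rewrite conflict_irr.
- move=> x y1 y2 y3 /conflictsP[i [j1 [-> -> h1]]] /conflictsP[i2 [j2 [/val_inj <- -> h2]]].
  move=> /conflictsP[i3 [j3 [/val_inj <- -> h3]]].
  by case: (path_degree_le2 paths h1 h2 h3) => ->; [constructor 1|constructor 2|constructor 3].
(* A set closed under conflict contains the whole component of each of its items, in particular an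
   end of that path. *)
- move=> W Wm Wc x Wx; have [h xh hu] := path_end paths (Ordinal (Wm x Wx)).
  have : W (Ordinal (Wm x Wx)) by [].
  move: (Ordinal _) xh => o oh Wo; exists (h : nat).
    case/connectP: oh => p; elim: p o Wo => [|z p IHp] o Wo /=; first by move=> _ ->.
    case/andP=> oz; apply: IHp; apply: Wc Wo _; apply/conflictsP.
    by exists o, z.
  apply: sum_bool_le1 => y z _ _ /conflictsP[i [j [/val_inj <- -> h1]]].
  by move=> /conflictsP[i' [k [/val_inj <- -> h2]]]; rewrite (hu j k).
Qed.

(** If [i] values the bundle of [i'] one above its own, that bundle contains an item liked by [i],
    so the maximum is at least 1. Otherwise a nonnegative maximum is enough. *)
Lemma ef1_output (s' : memory) : (forall j, j < m -> owner s' j < n) ->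
  envy_bounded n m (likes s) (owner s') ->
  (forall x y, conflicts x y -> owner s' x <> owner s' y) ->
  ef1_allocation (@output R I s').
Proof.
move=> g1 g2 g3.
have vE (i i' : 'I_(nagents I)) : valuation i (@output R I s' i') =
    (worth m (likes s) (owner s') i i')%:R%R.
  rewrite valuation_additive natr_sum [LHS]big_mkcond /=; apply: eq_bigr => j _.
  rewrite inE -/(owner s' j) -/(item_value i j) binary_input_likes.
  by case: eqP => _; rewrite ?andbT ?andbF.
split.
- split.
    apply/setP => j; rewrite inE; apply/bigcupP.
    by exists (Ordinal (g1 j (ltn_ord j))); rewrite ?inE.
  move=> i i' ii'; rewrite disjoint_subset; apply/subsetP => j.
  by rewrite !inE => /eqP ->.
- move=> i x y; rewrite !inE => /eqP xi /eqP yi; apply/negP => xy.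
  case: (g3 x y); first by apply/conflictsP; exists x, y.
  by rewrite /owner xi yi.
- move=> i i' _; rewrite !vE lerBlDr.
  have := g2 i i' (ltn_ord i) (ltn_ord i').
  rewrite leq_eqVlt => /orP[/eqP we|].
    have : \sum_(j < m) (likes s i j && (owner s' j == i')) != 0 by rewrite -/(worth _ _ _ _ _) we.
    rewrite (sum_bool_neq0 (fun j => likes s i j && (owner s' j == i'))).
    case/hasP => j; rewrite mem_iota => jm /andP[lij oj].
    rewrite we -addn1 natrD lerD2l.
    apply: (@le_trans _ _ (item_value i (Ordinal jm))).
      by rewrite binary_input_likes lij.
    by apply: le_bigmax_cond; rewrite inE.
  rewrite ltnS => wl; rewrite -[X in (X <= _)%R]addr0 lerD ?ler_nat //.
  exact: bigmax_ge_id.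
Qed.
End Instance.

Theorem proposition4 (R : realFieldType) :
  let admissible (I : instance R) :=
    [/\ 2 < nagents I, binary_values I & components_are_paths (@conflict R I)] in
  (forall I : instance R, admissible I ->
     exists A : bundles I, ef1_allocation A) /\
  found_in_polynomial_time admissible (fun I A => ef1_allocation A).
Proof.
move=> admissible.
have main (I : instance R) : admissible I ->
    ef1_allocation (@output R I (run main_block (binary_input I))).
  move=> [n3 binary paths].
  have [g1 g2 g3] := run_main_binary_input n3 paths.
  exact: ef1_output.
split; first by move=> I /main ?; eexists; eassumption.
have [a [k cost]] := exec_block main_block_well_formed.
exists (compile main_block), a, k => I hI.
have [||| t ex tk] := cost (binary_input I) (nagents I + nitems I).
- by case: hI => h _ _; lia.
- exact: leq_addr.
- exact: leq_addl.
by exists (run main_block (binary_input I)), t; split=> //; apply: main.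
Qed.
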